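(* There exist absolute constants $C,c>0$ and, for every $2<p<\infty$, constants $\alpha_p,C_p>0$ depending only on $p$, such that the following holds. Let $2<p<\infty$ and let $X=(\mathbb R^n,\|\cdot\|)$ be an $n$-dimensional subspace of $L_p$, represented on $\mathbb R^n$, whose unit ball $B_X$ is in Lewis' position. Let $Z$ be a standard $n$-dimensional Gaussian vector. Then $$\mathbb P\left(\big|\|Z\|-\mathbb E\|Z\|\big|>\varepsilon\,\mathbb E\|Z\|\right)\le C\exp\left(-c\min\left\{\alpha_p\varepsilon^2 n,(\varepsilon n)^{2/p}\right\}\right),\qquad 0<\varepsilon<1.$$ In particular, $$\mathrm{Var}\,\|Z\|\le C_p\,n^{2/p-1}.$$
   Context: $S^{n-1}$ is the Euclidean unit sphere of $\mathbb R^n$. An even Borel measure $\mu$ on $S^{n-1}$ is isotropic if $\|x\|_2^2=\int_{S^{n-1}}|\langle x,\theta\rangle|^2\,d\mu(\theta)$ for all $x\in\mathbb R^n$ (such a measure has total mass $n$). Every $n$-dimensional subspace of $L_p$ is linearly isometric to $\mathbb R^n$ equipped with a norm $\|x\|_{B_p(\mu)}=\left(\int_{S^{n-1}}|\langle x,\theta\rangle|^p\,d\mu(\theta)\right)^{1/p}$ for some isotropic $\mu$ (Lewis). The space $X$, represented on $\mathbb R^n$, has its unit ball in Lewis' position if its norm is $\|x\|=\|x\|_{B_p(\mu)}$ for some isotropic Borel measure $\mu$ on $S^{n-1}$. A standard Gaussian vector is $Z\sim N(\mathbf 0,I_n)$. *)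

(* Defs.v *)
From HB Require Import structures.
From mathcomp Require Import all_boot all_order all_algebra.
From mathcomp Require Import all_classical all_reals all_analysis.

Set Implicit Arguments.
Unset Strict Implicit.
Unset Printing Implicit Defensive.

Import Order.TTheory GRing.Theory Num.Theory.
Import numFieldNormedType.Exports.

Local Open Scope classical_set_scope.
Local Open Scope ring_scope.

(* The library's own norm on 'rV[R]_n is the sup norm, hence [dot] and [enorm]. *)
Definition dot (R : realType) (n : nat) (x y : 'rV[R]_n) : R :=
  \sum_(i < n) x ord0 i * y ord0 i.

Definition enorm (R : realType) (n : nat) (x : 'rV[R]_n) : R :=
  Num.sqrt (dot x x).

Definition sphere (R : realType) (n : nat) : set 'rV[R]_n :=
  [set x | enorm x = 1].

Definition borel_rV (R : realType) (n : nat) :=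
  g_sigma_algebraType (@open 'rV[R]_n).

(* A Borel measure on the sphere is encoded as a Borel measure on R^n that
   vanishes off the sphere. *)
Definition isotropic (R : realType) (n : nat)
    (mu : {measure set (borel_rV R n) -> \bar R}) : Prop :=
  [/\ mu (~` @sphere R n) = 0%E,
      forall A : set 'rV[R]_n, measurable (A : set (borel_rV R n)) ->
        mu (-%R @` A) = mu A
    & forall x : 'rV[R]_n,
        ((enorm x ^+ 2)%:E =
         \int[mu]_(theta in @sphere R n) (`|dot x theta| ^+ 2)%:E)%E].

Definition Bp_norm (R : realType) (n : nat) (p : R)
    (mu : {measure set (borel_rV R n) -> \bar R}) (x : 'rV[R]_n) : \bar R :=
  ((\int[mu]_(theta in @sphere R n) (`|dot x theta| `^ p)%:E) `^ p^-1)%E.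

Definition lewis_position (R : realType) (n : nat) (p : R)
    (nrm : 'rV[R]_n -> R) : Prop :=
  exists mu : {measure set (borel_rV R n) -> \bar R},
    isotropic mu /\ forall x, (nrm x)%:E = Bp_norm p mu x.

(* (R^n, nrm) is linearly isometric, through J, to a subspace of some L_p(nu).
   Together with the isometry, definiteness of nrm says that J remains injective
   modulo nu-a.e. equality, i.e. that the subspace has dimension n. *)
Definition Lp_subspace (R : realType) (n : nat) (p : R)
    (nrm : 'rV[R]_n -> R) : Prop :=
  (forall x, nrm x = 0 -> x = 0) /\
  exists (d : measure_display) (S : measurableType d)
         (nu : {measure set S -> \bar R})
         (J : {linear 'rV[R]_n -> (S -> R^o)}),
    forall x, (J x : S -> R) \in Lfun nu p%:E /\
              (nrm x)%:E = ('N[nu]_p%:E[EFin \o (J x : S -> R)])%E.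

(* Z ~ N(0, I_n): the coordinates are N(0, 1) and mutually independent.  The
   product rule over all n coordinates covers subfamilies: take A i = setT. *)
Definition std_gaussian (R : realType) (n : nat) (d : measure_display)
    (T : measurableType d) (P : probability T R)
    (Z : {RV P >-> borel_rV R n}) : Prop :=
  let Zi (i : 'I_n) (w : T) : R := (Z w : 'rV[R]_n) ord0 i in
  (forall (i : 'I_n) (A : set R), measurable A ->
     P (Zi i @^-1` A) = normal_prob (0 : R) 1 A) /\
  (forall A : 'I_n -> set R, (forall i, measurable (A i)) ->
     P [set w | forall i, A i (Zi i w)] = (\prod_(i < n) P (Zi i @^-1` A i))%E).

(* Main.v *)
(** Lewis' position turns the p-th power of the norm into A_p(x), where
    A_s(x) = ∫ |<x, θ>|^s dμ(θ) with μ isotropic.  If X and Y are independent standard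
    Gaussian vectors, then E |A_s(X) - A_s(Y)|^r is at most (2π)^r E |<∇A_s(X), Y>|^r:
    cut the rotation from X to Y into small steps, bound the increments with convexity
    of A_s, and use that every rotated pair has the law of (X, Y).  Given X, the variable
    <∇A_s(X), Y> is a centered Gaussian of standard deviation |∇A_s(X)|, and isotropy
    gives |∇A_s|^2 <= s^2 A_(2s-2).  Hence the centered moments of A_s of order 2k are
    controlled by the moments of A_(2s-2) of order k, and for k a power of two a recursion
    bounds all of them.  Markov's inequality for the best such k is the deviation bound
    for A_p, and taking p-th roots transfers it to the norm, whose mean is close to
    (E A_p)^(1/p) because of the second moment bound. *)
Require Import Defs.
From HB Require Import structures.
From mathcomp Require Import all_boot all_order all_algebra.
From mathcomp Require Import all_classical all_reals all_analysis.
From mathcomp Require Import measurable_realfun.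
From mathcomp Require Import ring lra.

Set Implicit Arguments.
Unset Strict Implicit.
Unset Printing Implicit Defensive.

Import Order.TTheory GRing.Theory Num.Theory.
Import numFieldNormedType.Exports.

Local Open Scope classical_set_scope.
Local Open Scope ring_scope.

(** The norm is 1-Lipschitz ([psum_le_enorm] and the triangle inequality), but Gaussian
    concentration for Lipschitz functions only gives an exponent of order ε^2 n^(2/p). The gain
    comes from measuring the gradient of A_s by A_(2s-2), a function of the same family. Each pass
    replaces the pair (s, 2k) of exponent and order by (2s-2, k); powers of two therefore lead down
    to order 1, where E A_s = n E|g|^s for a standard normal g, since each θ has length 1 and μ has
    mass n. Numerical factors do not pile up: a centered norm is bounded by the square root of the
    next norm, so a factor C returns as a multiple of sqrt C. The constant c is absolute because
    E|g|^p is p^(p/2) up to a factor exponential in p, and in the range governed by (εn)^(2/p) such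
    factors enter through their p-th root. The other losses go into α_p. Nothing is differentiated
    along the rotation: tangent inequalities at both ends of a small step give its first order part,
    and the second order error vanishes as the number of steps grows. The variance bound is not an
    integrated tail; it comes from the moment of order 2, which also locates the mean. *)

Section rotation2.
Context {R : realType}.
Notation leb := (@lebesgue_measure R).
Notation gam := (normal_prob (0 : R) 1).
Notation phi := (normal_pdf (0 : R) 1).

(** * Rotation invariance of the Gaussian measure in the plane *)

Lemma lebesgue_measure_shift (a : R) (A : set R) : measurable A ->
  pushforward leb ((fun x => x + a) : _ -> measurableTypeR R) A = leb A.
Proof.
move=> mA; apply/esym/lebesgue_measure_unique => //=; first by apply: measurable_funD.
move=> ? _ [[b c]] _ <-.
rewrite /pushforward.
have -> : (fun x => x + a) @^-1` [set` `]b, c]] = [set` `]b - a, c - a]].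
  by apply/seteqP; split => x /=; rewrite !in_itv/=; move=> /andP[? ?]; apply/andP; split; lra.
rewrite !lebesgue_measure_itv/= !lte_fin ltrD2r -!EFinB.
by rewrite opprB addrA subrK.
Qed.

Lemma ge0_integral_shift (a : R) (f : R -> \bar R) :
  measurable_fun [set: measurableTypeR R] f -> (forall x, 0 <= f x)%E ->
  (\int[leb]_x f (x + a)%R = \int[leb]_x f x)%E.
Proof.
move=> mf f0.
have ms : measurable_fun setT ((fun x => x + a) : measurableTypeR R -> measurableTypeR R).
  by apply: measurable_funD.
have -> : (\int[leb]_x f x = \int[pushforward leb ((fun x => x + a)%R : _ -> measurableTypeR R)]_x f x)%E.
  by apply: eq_measure_integral => A mA _; apply/esym/lebesgue_measure_shift.
by rewrite ge0_integral_pushforward.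
Qed.

Import HBNNSimple.

(** [normal_prob] integrates its density over sets, which settles indicators; simple approximations
    and monotone convergence on both sides do the rest. *)
Lemma ge0_integral_gauss (f : R -> \bar R) :
  measurable_fun [set: measurableTypeR R] f -> (forall x, 0 <= f x)%E ->
  (\int[gam]_x f x = \int[leb]_x (f x * (phi x)%:E))%E.
Proof.
move=> mf f0.
have mphi : measurable_fun [set: measurableTypeR R] (EFin \o phi).
  by apply/measurable_EFinP; exact: measurable_normal_pdf.
pose h := nnsfun_approx measurableT mf.
have -> : (\int[gam]_x f x = limn (fun n => \int[gam]_x (h n x)%:E))%E.
  rewrite -monotone_convergence//.
  - by apply: eq_integral => x _; apply/esym/cvg_lim => //; apply: cvg_nnsfun_approx.
  - by move=> n; exact/measurable_EFinP.
  - by move=> *; rewrite lee_fin.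
  - by move=> x _ m n mn; rewrite lee_fin; exact/lefP/nd_nnsfun_approx.
have -> : (\int[leb]_x (f x * (phi x)%:E) =
  limn (fun n => \int[leb]_x ((h n x)%:E * (phi x)%:E)))%E.
  rewrite -monotone_convergence//.
  - apply: eq_integral => x _; apply/esym/cvg_lim => //.
    by apply: cvgeZr => //; exact: cvg_nnsfun_approx.
  - by move=> n; apply: emeasurable_funM => //; exact/measurable_EFinP.
  - by move=> n x _; rewrite mule_ge0// lee_fin ?normal_pdf_ge0.
  - move=> x _ m n mn; rewrite lee_wpmul2r ?lee_fin ?normal_pdf_ge0//.
    exact/lefP/nd_nnsfun_approx.
congr (limn _); apply/funext => n.
under eq_integral do rewrite fimfunE -fsumEFin//.
under [RHS]eq_integral => x _.
  rewrite fimfunE -fsumEFin// ge0_mule_fsuml//; last first.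
    by move=> r; rewrite nnfun_muleindic_ge0.
  over.
rewrite ge0_integral_fsum//; last 2 first.
- by move=> r; exact/measurable_EFinP/measurableT_comp.
- by move=> r x _; rewrite nnfun_muleindic_ge0.
rewrite ge0_integral_fsum//; last 2 first.
- by move=> r; apply: emeasurable_funM => //; exact/measurable_EFinP/measurableT_comp.
- move=> r x _; apply: mule_ge0; last by rewrite lee_fin normal_pdf_ge0.
  by rewrite EFinM nnfun_muleindic_ge0.
apply: eq_fsbigr => r rh.
rewrite integralZl_indic_nnsfun//= integral_indic//= setIT.
have -> : (\int[leb]_x ((r * \1_(h n @^-1` [set r]) x)%:E * (phi x)%:E) =
   \int[leb]_x (r%:E * ((\1_(h n @^-1` [set r]) x)%:E * (phi x)%:E)))%E.
  by apply: eq_integral => x _; rewrite EFinM muleA.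
have r0 : 0 <= r by move: rh; rewrite inE => -[x _ <-].
rewrite ge0_integralZl//; last 2 first.
- by apply: emeasurable_funM => //; exact/measurable_EFinP.
- by move=> x _; rewrite mule_ge0// lee_fin ?normal_pdf_ge0.
rewrite /normal_prob [X in (_ * X)%E]integral_mkcond; congr (_ * _)%E.
by apply: eq_integral => x _; rewrite epatch_indic /= muleC.
Qed.

Notation Rm := (measurableTypeR R).

Lemma ge0_integral_shear2 (b : R) (H : Rm * Rm -> \bar R) :
  measurable_fun [set: Rm * Rm] H -> (forall z, 0 <= H z)%E ->
  (\int[leb]_x \int[leb]_y H (x, y + b * x)%R =
   \int[leb]_x \int[leb]_y H (x, y))%E.
Proof.
move=> mH H0; apply: eq_integral => x _.
apply: (@ge0_integral_shift (b * x) (fun y => H (x, y))) => // .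
exact: (measurableT_comp mH (measurable_pair1 x)).
Qed.

Lemma measurable_shear1 (a : R) :
  measurable_fun [set: Rm * Rm] (fun z : Rm * Rm => (z.1 + a * z.2, z.2) : Rm * Rm).
Proof.
apply: measurable_fun_pair => //=.
by apply: measurable_funD => //; apply: measurable_funM.
Qed.

Lemma measurable_shear2 (b : R) :
  measurable_fun [set: Rm * Rm] (fun z : Rm * Rm => (z.1, z.2 + b * z.1) : Rm * Rm).
Proof.
apply: measurable_fun_pair => //=.
by apply: measurable_funD => //; apply: measurable_funM.
Qed.

Lemma ge0_integral_shear1 (a : R) (H : Rm * Rm -> \bar R) :
  measurable_fun [set: Rm * Rm] H -> (forall z, 0 <= H z)%E ->
  (\int[leb]_x \int[leb]_y H (x + a * y, y)%R =
   \int[leb]_x \int[leb]_y H (x, y))%E.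
Proof.
move=> mH H0.
have /= := @fubini_tonelli _ _ _ _ R leb leb (fun z => H (z.1 + a * z.2, z.2)%R).
rewrite /fubini_F /fubini_G/= => ->//; last first.
  exact: (measurableT_comp mH (measurable_shear1 a)).
have /= := @fubini_tonelli _ _ _ _ R leb leb H.
rewrite /fubini_F /fubini_G/= => ->//.
apply: eq_integral => y _ /=.
apply: (@ge0_integral_shift (a * y) (fun x => H (x, y))) => //.
exact: (measurableT_comp mH (measurable_pair2 y)).
Qed.

Definition rot2 (c s : R) (z : Rm * Rm) : Rm * Rm :=
  (c * z.1 + s * z.2, - s * z.1 + c * z.2).

Lemma measurable_rot2 c s : measurable_fun [set: Rm * Rm] (rot2 c s).
Proof.
by apply: measurable_fun_pair => //=; apply: measurable_funD => //; apply: measurable_funM.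
Qed.

(* A rotation is a product of three shears, each of which preserves Lebesgue
   measure by Fubini and translation invariance. *)
Lemma ge0_integral_rot2_lebesgue (c s : R) (H : Rm * Rm -> \bar R) :
  c ^+ 2 + s ^+ 2 = 1 -> c != -1 ->
  measurable_fun [set: Rm * Rm] H -> (forall z, 0 <= H z)%E ->
  (\int[leb]_x \int[leb]_y H (rot2 c s (x, y)) =
   \int[leb]_x \int[leb]_y H (x, y))%E.
Proof.
move=> cs1 c1 mH H0.
have c10 : 1 + c != 0 by rewrite addrC addr_eq0.
(* [a] is the tangent of half the angle, finite because [c != -1] excludes the half-turn. The
   rotation is the shear by [a], then by [- s], then by [a] again. *)
pose a := s / (1 + c).
have E (x y : R) : rot2 c s (x, y) =
    (x + a * y + a * (y + - s * (x + a * y)), y + - s * (x + a * y)).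
  have E1 : a * s = 1 - c.
    have s2 : s * s = (1 - c) * (1 + c) by nra.
    by rewrite /a mulrAC s2 mulfK.
  have E2 : a * c = s - a by rewrite /a; field.
  rewrite /rot2/=; congr pair.
    have -> : x + a * y + a * (y + - s * (x + a * y)) =
      (1 - a * s) * x + (2 * a - a * (a * s)) * y by ring.
    by rewrite E1; congr (_ * _ + _ * _); lra.
  have -> : y + - s * (x + a * y) = - s * x + (1 - a * s) * y by ring.
  by rewrite E1; congr (_ + _ * _); lra.
pose H1 (z : Rm * Rm) := H (z.1 + a * z.2, z.2).
have mH1 : measurable_fun [set: Rm * Rm] H1.
  exact: (measurableT_comp mH (measurable_shear1 a)).
pose H2 (z : Rm * Rm) := H1 (z.1, z.2 + - s * z.1).
have mH2 : measurable_fun [set: Rm * Rm] H2.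
  exact: (measurableT_comp mH1 (measurable_shear2 (- s))).
apply: (etrans _ (ge0_integral_shear1 a mH H0)).
apply: (etrans _ (ge0_integral_shear2 (- s) mH1 (fun=> H0 _))).
apply: (etrans _ (ge0_integral_shear1 a mH2 (fun=> H0 _))).
by apply: eq_integral => x _; apply: eq_integral => y _; rewrite E.
Qed.

Lemma phiE (x : R) : phi x = (Num.sqrt (pi *+ 2))^-1 * expR (- x ^+ 2 / 2).
Proof.
rewrite normal_pdfE ?oner_eq0// /normal_peak /normal_fun expr1n mul1r subr0.
by [].
Qed.

(** The joint density is a function of x^2 + y^2, which the rotation preserves, so only the Lebesgue
    integral has to be moved. *)
Lemma gauss2_rot2 (c s : R) (D : set (Rm * Rm)) :
  c ^+ 2 + s ^+ 2 = 1 -> c != -1 -> measurable D ->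
  (gam \x gam)%E (rot2 c s @^-1` D) = (gam \x gam)%E D.
Proof.
move=> cs1 c1 mD.
have mrD : measurable (rot2 c s @^-1` D).
  by rewrite -[X in measurable X]setTI; exact: measurable_rot2.
have mphi : measurable_fun [set: Rm] phi by exact: measurable_normal_pdf.
have key (E : set (Rm * Rm)) : measurable E -> (gam \x gam)%E E =
    (\int[leb]_x \int[leb]_y (\1_E (x, y) * (phi x * phi y))%:E)%E.
  move=> mE.
  rewrite /product_measure1 ge0_integral_gauss//; last exact: measurable_fun_xsection.
  apply: eq_integral => x _ /=.
  rewrite /normal_prob integral_mkcond muleC -ge0_integralZl//; last 3 first.
  - apply/(measurable_restrictT _ _).1; first exact: measurable_xsection.
    by apply/measurable_EFinP/measurable_funTS.
  - by move=> y _; rewrite erestrict_ge0// => z _; rewrite lee_fin normal_pdf_ge0.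
  - by rewrite lee_fin normal_pdf_ge0.
  apply: eq_integral => y _; rewrite epatch_indic/= -!EFinM.
  rewrite !indicE mem_xsection; congr EFin; ring.
rewrite (key _ mrD) (key _ mD).
pose H (z : Rm * Rm) := (\1_D z * (phi z.1 * phi z.2))%:E.
have mH : measurable_fun [set: Rm * Rm] H.
  apply/measurable_EFinP; apply: measurable_funM; first exact: measurable_indic.
  by apply: measurable_funM; apply: measurableT_comp.
have H0 z : (0 <= H z)%E by rewrite lee_fin !mulr_ge0// normal_pdf_ge0.
apply: (etrans _ (ge0_integral_rot2_lebesgue cs1 c1 mH H0)).
apply: eq_integral => x _; apply: eq_integral => y _.
rewrite /H; congr EFin; congr (_ * _).
rewrite !phiE /= mulrACA [RHS]mulrACA -!expRD; congr (_ * expR _).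
rewrite -[LHS]mul1r -cs1; field.
by rewrite cs1 oner_neq0.
Qed.

End rotation2.

(** * Borel sets of R^n through boxes *)

Section borel.
Context {R : realType} {N : nat}.
Notation Rm := (measurableTypeR R).
Notation BN := (borel_rV R N).

Definition box (A : 'I_N -> set R) : set 'rV[R]_N :=
  [set x | forall i, A i (x ord0 i)].

Lemma measurable_coord (i : 'I_N) :
  measurable_fun [set: BN] ((fun x : 'rV[R]_N => x ord0 i) : BN -> Rm).
Proof.
apply: (measurability _ (RGenOInfty.measurableE R)) => // _ [_ [a ->] <-].
rewrite setTI; apply: sub_sigma_algebra.
have := @coord_continuous R 1 N ord0 i.
move/continuousP => /(_ `]a, +oo[%classic); apply.
exact: interval_open.
Qed.

(** An open set is the union of the boxes with rational endpoints that it contains, and there are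
    only countably many of them. *)
Lemma measurable_rowP d (T : measurableType d) (f : T -> BN) :
  (forall i, measurable_fun [set: T] ((fun t => (f t : 'rV[R]_N) ord0 i) : T -> Rm)) ->
  measurable_fun [set: T] f.
Proof.
move=> mf; apply: (@measurability _ _ T BN setT f (@open 'rV[R]_N)) => //.
move=> _ [U oU <-]; rewrite setTI.
pose bx (r : {ffun 'I_N -> rat * rat}) : set 'rV[R]_N :=
  box (fun i => (`]ratr (r i).1, ratr (r i).2[%classic : set R)).
have -> : U = \bigcup_(r in [set r | bx r `<=` U]) bx r.
  apply/seteqP; split => [x Ux|x [r rU]]; last exact: rU.
  have : nbhs x U by apply: open_nbhs_nbhs.
  rewrite -nbhs_ballE => -[e /= e0 eU].
  have /(_ _)/cid-/all_sig[u hu] (i : 'I_N) : exists u : rat * rat,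
      [/\ x ord0 i - e < ratr u.1, ratr u.1 < x ord0 i, x ord0 i < ratr u.2
        & ratr u.2 < x ord0 i + e].
    have [|q] := @rat_in_itvoo R (x ord0 i - e) (x ord0 i); first by rewrite ltrBlDr ltrDl.
    have [|q'] := @rat_in_itvoo R (x ord0 i) (x ord0 i + e); first by rewrite ltrDl.
    rewrite !in_itv/= => /andP[h1 h2] /andP[h3 h4].
    by exists (q, q').
  exists [ffun i => u i].
    move=> y /= hy; apply: eU; rewrite /ball/=; split => // j i.
    rewrite (ord1 j) /ball/=; have := hy i; have [h1 h2 h3 h4] := hu i.
    rewrite /= ffunE in_itv/= => /andP[h5 h6].
    by rewrite ltr_norml; apply/andP; split; lra.
  move=> i /=; rewrite ffunE in_itv/=; have [h1 h2 h3 h4] := hu i.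
  by rewrite h2 h3.
rewrite bigcup_mkcond preimage_bigcup.
apply: countable_bigcupT_measurable; first exact: countableP.
move=> r; case: ifPn => _; last by rewrite preimage_set0.
have -> : f @^-1` bx r = \bigcap_i ((fun t => (f t : 'rV[R]_N) ord0 i) @^-1`
    (`]ratr (r i).1, ratr (r i).2[%classic : set R)).
  by apply/seteqP; split => [t ht i _|t ht i]; exact: ht.
apply: fin_bigcap_measurable; first exact: finite_finset.
by move=> i _; rewrite -[X in measurable X]setTI; apply: mf.
Qed.

Lemma measurable_box (A : 'I_N -> set R) :
  (forall i, measurable (A i : set Rm)) -> measurable (box A : set BN).
Proof.
move=> mA.
have -> : box A = \bigcap_i ((fun x : 'rV[R]_N => x ord0 i) @^-1` A i).
  by apply/seteqP; split => [t ht i _|t ht i]; exact: ht.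
apply: fin_bigcap_measurable; first exact: finite_finset.
by move=> i _; rewrite -[X in measurable X]setTI; apply: measurable_coord.
Qed.

Definition boxes : set (set 'rV[R]_N) :=
  [set B | exists2 A : 'I_N -> set R, (forall i, measurable (A i : set Rm)) & B = box A].

(** For the nontrivial inclusion, view the identity as a map from the sigma-algebra of boxes to the
    Borel one: its coordinates are measurable, hence so is the map. *)
Lemma measurable_boxesE : (@measurable _ BN) = <<s boxes >>.
Proof.
apply/seteqP; split; last first.
  apply: smallest_sub; first exact: sigma_algebra_measurable.
  by move=> _ [A mA ->]; exact: measurable_box.
move=> B mB.
have := @measurable_rowP _ (g_sigma_algebraType boxes) id.
move=> /(_ _ measurableT B mB); rewrite setTI; apply => i.
move=> _ Y mY; rewrite setTI; apply: sub_sigma_algebra.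
exists (fun j => if j == i then Y else setT).
  by move=> j; case: ifPn.
apply/seteqP; split => [x /= xY j|x /(_ i)/=]; last by rewrite eqxx.
by case: eqVneq => // ->.
Qed.

Lemma boxes_unique (m1 m2 : {measure set BN -> \bar R}) :
  (m1 setT < +oo)%E ->
  (forall A : 'I_N -> set R, (forall i, measurable (A i : set Rm)) ->
    m1 (box A) = m2 (box A)) ->
  forall B : set BN, measurable B -> m1 B = m2 B.
Proof.
move=> m1oo m12 B mB.
apply: (@measure_unique _ R BN boxes (fun=> setT)) => //.
- exact: measurable_boxesE.
- move=> _ _ [A mA ->] [A' mA' ->]; exists (fun i => A i `&` A' i).
    by move=> i; exact: measurableI.
  by apply/seteqP; split => [x [h h'] i|x h]; split => //i; have [] := h i.
- by move=> _; exists (fun=> setT) => //; apply/seteqP; split.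
- by apply/seteqP; split => // x _; exists 0%N.
- by move=> _ [A mA ->]; exact: m12.
Qed.

End borel.

(** * Standard Gaussian laws on R^n and rotations of a coordinate plane *)

Section gauss_law.
Context {R : realType}.
Notation Rm := (measurableTypeR R).
Notation gam := (normal_prob (0 : R) 1).

(** A finite measure is determined by its boxes ([boxes_unique]), and this product rule is the only
    form in which the law of Z is used. *)
Definition gauss_law N (Q : probability (borel_rV R N) R) : Prop :=
  forall A : 'I_N -> set R, (forall i, measurable (A i : set Rm)) ->
    Q (box A) = (\prod_(i < N) gam (A i))%E.

Definition givens N (i j : 'I_N) (c s : R) (x : 'rV[R]_N) : 'rV[R]_N :=
  \row_k (if k == i then c * x ord0 i + s * x ord0 j else
          if k == j then - s * x ord0 i + c * x ord0 j else x ord0 k).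

Lemma measurable_givens N (i j : 'I_N) (c s : R) :
  measurable_fun [set: borel_rV R N] (givens i j c s : borel_rV R N -> borel_rV R N).
Proof.
apply: measurable_rowP => k; under eq_fun do rewrite mxE.
have mi l := @measurable_coord R N l.
case: (eqVneq k i) => _; last case: (eqVneq k j) => _; last exact: mi.
  by apply: measurable_funD; apply: measurable_funM => //; exact: mi.
by apply: measurable_funD; apply: measurable_funM => //; exact: mi.
Qed.

Lemma bigprodD2 N (i j : 'I_N) (F : 'I_N -> \bar R) : i != j ->
  (\prod_k F k = F i * F j * \prod_(k | (k != i) && (k != j)) F k)%E.
Proof.
move=> ij; rewrite (bigD1 i)//= (bigD1 j)/=; last by rewrite eq_sym.
by rewrite muleA.
Qed.

(** A rotated rectangle is no longer a rectangle, so two coordinates must be allowed an arbitrary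
    planar constraint [D] while the others stay in a box. As functions of [D], both sides are finite
    measures that agree on rectangles. *)
Lemma gauss_law_pair N (Q : probability (borel_rV R N) R) (i j : 'I_N)
    (A : 'I_N -> set R) (D : set (Rm * Rm)) : gauss_law Q -> i != j ->
  (forall k, measurable (A k : set Rm)) -> measurable D ->
  Q [set x | D ((x : 'rV[R]_N) ord0 i, (x : 'rV[R]_N) ord0 j) /\
       forall k, k != i -> k != j -> A k ((x : 'rV[R]_N) ord0 k)] =
  ((gam \x gam) D * \prod_(k | (k != i) && (k != j)) gam (A k))%E.
Proof.
move=> QG ij mA mD.
(* [kap] is the mass left by the constraints on the other coordinates. The measures compared are
   [kap] times the planar Gaussian measure, and the law of the coordinates [i] and [j] restricted to
   these constraints. *)
pose kap := (\prod_(k | (k != i) && (k != j)) gam (A k))%E.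
have kap0 : (0 <= kap)%E by apply: prode_ge0.
have kfin : kap \is a fin_num.
  by rewrite /kap; elim/big_ind : _ => // [x y|k _]; [exact: fin_numM|exact: fin_num_measure].
pose W : set (borel_rV R N) := box (fun k => if (k == i) || (k == j) then setT else A k).
have mW : measurable W by apply: measurable_box => k; case: ifP.
pose pr (x : borel_rV R N) : Rm * Rm := ((x : 'rV[R]_N) ord0 i, (x : 'rV[R]_N) ord0 j).
have mpr : measurable_fun [set: borel_rV R N] pr.
  by apply: measurable_fun_pair; exact: measurable_coord.
pose rk : {nonneg R} := NngNum (fine_ge0 kap0).
pose m1 : {measure set (Rm * Rm) -> \bar R} := mscale rk (gam \x gam)%E.
pose m20 : {measure set (Rm * Rm) -> \bar R} := pushforward (mrestr Q mW) pr.
pose m2 := m20 mpr.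
have m2E (E : set (Rm * Rm)) : m2 E = Q [set x | E (pr x) /\
    forall k, k != i -> k != j -> A k ((x : 'rV[R]_N) ord0 k)].
  rewrite /m2 /pushforward /mrestr; congr (Q _).
  apply/seteqP; split => [x [Ex Wx]|x [Ex Wx]]; split => // k.
    by move=> ki kj; have := Wx k; rewrite (negbTE ki) (negbTE kj).
  by case: ifPn => // /norP[ki kj]; exact: Wx.
apply: (etrans (esym (m2E D))).
have m1E E : m1 E = (kap * (gam \x gam)%E E)%E.
  by change ((fine kap)%:E * (gam \x gam)%E E = kap * (gam \x gam)%E E)%E; rewrite fineK.
transitivity (m1 D); last by rewrite m1E muleC.
apply/esym.
pose C : set (set (Rm * Rm)) :=
  [set C | exists A, measurable A /\ exists B, measurable B /\ C = A `*` B].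
apply: (@measure_unique _ R (Rm * Rm)%type C (fun=> setT) _ _ _ _ m1 m2) => //.
- rewrite measurable_prod_measurableType //; congr (<<s _ >>).
  rewrite predeqE; split => [[A0 mA0 [B mB <-]]|[A0 [mA0 [B [mB ->]]]]].
    by exists A0; split => //; exists B.
  by exists A0 => //; exists B.
- move=> /= _ _ [X1 [mX1 [X2 [mX2 ->]]]] [Y1 [mY1 [Y2 [mY2 ->]]]].
  rewrite -setXI; exists (X1 `&` Y1); split; first exact: measurableI.
  by exists (X2 `&` Y2); split => //; exact: measurableI.
- by move=> _; exists setT; split => //; exists setT; split => //; rewrite setXTT.
- by apply/seteqP; split => // x _; exists 0%N.
- move=> _ [B1 [mB1 [B2 [mB2 ->]]]]; rewrite m2E m1E.
  rewrite product_measure1E//.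
  have -> : [set x | (B1 `*` B2) (pr x) /\
    forall k, k != i -> k != j -> A k ((x : 'rV[R]_N) ord0 k)] =
    box (fun k => if k == i then B1 else if k == j then B2 else A k).
    apply/seteqP; split => [x [[b1 b2] h] k|x h].
      case: eqVneq => [->//|ki]; case: eqVneq => [->//|kj]; exact: h.
    split; last by move=> k ki kj; have := h k; rewrite (negbTE ki) (negbTE kj).
    have hi := h i; have hj := h j.
    by move: hi hj; rewrite !eqxx eq_sym (negbTE ij).
  rewrite QG; last by move=> k; do 2 case: ifP => //.
  rewrite (bigprodD2 _ ij) !eqxx eq_sym (negbTE ij) muleC; congr (_ * _)%E.
  by apply: eq_bigr => k /andP[/negbTE -> /negbTE ->].
- move=> _; rewrite m1E.
  by have -> : ((gam \x gam) setT = 1)%E; [exact: (@probability_setT _ _ R (gam \x gam)%E)|rewrite mule1 ltey_eq kfin].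
Qed.

(** It is enough to test boxes; the preimage of a box is a rotated rectangle in the plane of [i] and
    [j] times a box in the other coordinates. *)
Lemma gauss_law_givens N (Q : probability (borel_rV R N) R) (i j : 'I_N) (c s : R) :
  gauss_law Q -> i != j -> c ^+ 2 + s ^+ 2 = 1 -> c != -1 ->
  forall B : set (borel_rV R N), measurable B -> Q (givens i j c s @^-1` B) = Q B.
Proof.
move=> QG ij cs c1 B mB.
pose g : borel_rV R N -> borel_rV R N := givens i j c s.
pose m10 : {measure set (borel_rV R N) -> \bar R} := pushforward Q g.
pose m1 := m10 (measurable_givens i j c s).
apply: (@boxes_unique R N m1 Q) => //.
  change (Q (g @^-1` setT) < +oo)%E.
  by rewrite preimage_setT probability_setT ltry.
move=> A mA; change (Q (g @^-1` box A) = Q (box A)); rewrite [RHS]QG// /g.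
have mAA : measurable (A i `*` A j : set (Rm * Rm)) by exact: measurableX.
have -> : givens i j c s @^-1` box A = [set x |
    (rot2 c s @^-1` (A i `*` A j)) ((x : 'rV[R]_N) ord0 i, (x : 'rV[R]_N) ord0 j) /\
       forall k, k != i -> k != j -> A k ((x : 'rV[R]_N) ord0 k)].
  apply/seteqP; split => [x h|x [[/= h1 h2] h] k].
    split; last by move=> k ki kj; have := h k; rewrite /givens mxE (negbTE ki) (negbTE kj).
    by split => /=; [have := h i|have := h j]; rewrite /givens mxE ?eqxx// eq_sym (negbTE ij).
  rewrite /givens mxE; case: eqVneq => [->//|ki]; case: eqVneq => [->//|kj].
  exact: h.
rewrite gauss_law_pair//; last first.
  by rewrite -[X in measurable X]setTI; exact: measurable_rot2.
by rewrite gauss2_rot2// product_measure1E// (bigprodD2 _ ij).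
Qed.

Lemma ge0_integral_givens N (Q : probability (borel_rV R N) R) (i j : 'I_N) (c s : R)
    (F : borel_rV R N -> \bar R) :
  gauss_law Q -> i != j -> c ^+ 2 + s ^+ 2 = 1 -> c != -1 ->
  measurable_fun setT F -> (forall x, 0 <= F x)%E ->
  (\int[Q]_x F (givens i j c s x) = \int[Q]_x F x)%E.
Proof.
move=> QG ij cs c1 mF F0.
pose g : borel_rV R N -> borel_rV R N := givens i j c s.
transitivity (\int[pushforward Q g]_x F x)%E.
  by rewrite ge0_integral_pushforward//; exact: measurable_givens.
apply: eq_measure_integral => [|mg A mA _]; first exact: measurable_givens.
exact: (gauss_law_givens QG ij cs c1 mA).
Qed.

End gauss_law.

(** * Rotating a pair of independent Gaussian vectors *)

Section doubling.
Context {R : realType} {n : nat}.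
Notation Rm := (measurableTypeR R).
Notation gam := (normal_prob (0 : R) 1).
Notation Bn := (borel_rV R n).
Notation B2 := (borel_rV R (n + n)).
Context (Q : probability Bn R).
Context (QG : gauss_law Q).

Lemma measurable_row_mx :
  measurable_fun [set: Bn * Bn] ((fun z => row_mx z.1 z.2) : Bn * Bn -> B2).
Proof.
apply: measurable_rowP => k.
rewrite -(splitK k); case: (fintype.split k) => i /=.
- under eq_fun do rewrite row_mxEl.
  exact: (measurableT_comp (@measurable_coord R n i)).
- under eq_fun do rewrite row_mxEr.
  exact: (measurableT_comp (@measurable_coord R n i)).
Qed.

Definition row2 : {mfun (Bn * Bn)%type >-> B2} := mfun_Sub (mem_set measurable_row_mx).

(** The pair is concatenated into one Gaussian vector of length [n + n], so that rotating it is a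
    product of rotations in the planes of the coordinates k and n + k. *)
Definition law2 : probability B2 R := distribution (Q \x Q)%E row2.

Lemma gauss_law2 : gauss_law law2.
Proof.
move=> A mA.
change ((Q \x Q)%E (row2 @^-1` box A) = (\prod_(i < n + n) gam (A i))%E).
have -> : row2 @^-1` box A = box (A \o lshift n) `*` box (A \o @rshift n n).
  apply/seteqP; split => [z h|z [h1 h2] k].
    by split => i; [have := h (lshift n i)|have := h (rshift n i)];
      rewrite /row2/= ?row_mxEl ?row_mxEr.
  rewrite -(splitK k); case: (fintype.split k) => i /=; rewrite ?row_mxEl ?row_mxEr.
    exact: h1.
  exact: h2.
rewrite product_measure1E; [|by apply: measurable_box => i; exact: mA..].
rewrite big_split_ord/=; congr (_ * _)%E; apply: QG => i; exact: mA.
Qed.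

Lemma ge0_integral_law2 (F : Bn * Bn -> \bar R) :
  measurable_fun [set: Bn * Bn] F -> (forall z, 0 <= F z)%E ->
  (\int[law2]_z F (lsubmx z, rsubmx z) = \int[Q]_x \int[Q]_y F (x, y))%E.
Proof.
move=> mF F0.
have mlr : measurable_fun [set: B2] ((fun z => (lsubmx z, rsubmx z)) : B2 -> Bn * Bn).
  apply: measurable_fun_pair; apply: measurable_rowP => i; under eq_fun do rewrite mxE.
    exact: measurable_coord.
  exact: measurable_coord.
rewrite ge0_integral_distribution//; last exact: measurableT_comp mF mlr.
rewrite -fubini_tonelli1//.
by apply: eq_integral => -[x y] _ /=; rewrite row_mxKl row_mxKr.
Qed.

(** Only the first [k] pairs of coordinates are rotated: an interpolation between the identity and
    the full rotation, advanced by one Givens rotation at a time. *)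
Definition rotk (c s : R) (k : nat) (z : 'rV[R]_(n + n)) : 'rV[R]_(n + n) :=
  row_mx (\row_i (if (i < k)%N then c * lsubmx z ord0 i + s * rsubmx z ord0 i
                  else lsubmx z ord0 i))
         (\row_i (if (i < k)%N then - s * lsubmx z ord0 i + c * rsubmx z ord0 i
                  else rsubmx z ord0 i)).

Lemma rotkS (c s : R) (k : 'I_n) z :
  rotk c s k.+1 z = givens (lshift n k) (rshift n k) c s (rotk c s k z).
Proof.
apply/rowP => m; rewrite /rotk /givens [RHS]mxE !row_mxEl !row_mxEr.
rewrite -(splitK m); case: (fintype.split m) => i /=.
  rewrite !row_mxEl ![in RHS]mxE ltnn [LHS]mxE eq_lshift eq_lrshift ltnS leq_eqVlt val_eqE.
  by case: (eqVneq i k) => [->|ik] /=; [|case: ifP => _]; rewrite ?mxE.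
rewrite !row_mxEr ![in RHS]mxE ltnn [LHS]mxE eq_rlshift eq_rshift ltnS leq_eqVlt val_eqE.
by case: (eqVneq i k) => [->|ik] /=; [|case: ifP => _]; rewrite ?mxE.
Qed.

Lemma ge0_integral_rotk (c s : R) (k : nat) (F : B2 -> \bar R) :
  c ^+ 2 + s ^+ 2 = 1 -> c != -1 -> (k <= n)%N ->
  measurable_fun [set: B2] F -> (forall x, 0 <= F x)%E ->
  (\int[law2]_x F (rotk c s k x) = \int[law2]_x F x)%E.
Proof.
move=> cs c1; elim: k F => [F _ mF F0|k IH F kn mF F0].
  apply: eq_integral => z _; rewrite -[in RHS](@hsubmxK _ 1 n n z).
  by congr F; congr row_mx; apply/rowP => i; rewrite !mxE.
pose F' z := F (givens (lshift n (Ordinal kn)) (rshift n (Ordinal kn)) c s z).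
have mF' : measurable_fun [set: B2] F'.
  by apply: (measurableT_comp mF); exact: measurable_givens.
transitivity (\int[law2]_x F' (rotk c s k x))%E.
  by apply: eq_integral => z _; rewrite /F' -rotkS.
rewrite (IH F' (ltnW kn) mF')//; last by move=> z; exact: F0.
apply: ge0_integral_givens => //; first exact: gauss_law2.
by rewrite eq_lrshift.
Qed.

Lemma ge0_integral_gauss_rot (c s : R) (F : Bn * Bn -> \bar R) :
  c ^+ 2 + s ^+ 2 = 1 -> c != -1 ->
  measurable_fun [set: Bn * Bn] F -> (forall z, 0 <= F z)%E ->
  (\int[Q]_x \int[Q]_y F ((c *: x + s *: y)%R, (- s *: x + c *: y)%R)
    = \int[Q]_x \int[Q]_y F (x, y))%E.
Proof.
move=> cs c1 mF F0.
rewrite -ge0_integral_law2//.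
pose G (z : B2) := F (lsubmx z, rsubmx z).
have mlr : measurable_fun [set: B2] ((fun z => (lsubmx z, rsubmx z)) : B2 -> Bn * Bn).
  apply: measurable_fun_pair; apply: measurable_rowP => i; under eq_fun do rewrite mxE.
    exact: measurable_coord.
  exact: measurable_coord.
have mG : measurable_fun [set: B2] G by exact: measurableT_comp mF mlr.
have G0 z : (0 <= G z)%E by exact: F0.
rewrite -(ge0_integral_rotk cs c1 (leqnn n) mG G0).
pose F' (z : Bn * Bn) := F (c *: z.1 + s *: z.2, - s *: z.1 + c *: z.2).
have mrot : measurable_fun [set: Bn * Bn] ((fun z => (c *: z.1 + s *: z.2, - s *: z.1 + c *: z.2)) : Bn * Bn -> Bn * Bn).
  have h1 i : measurable_fun [set: Bn * Bn] ((fun z => (z.1 : 'rV[R]_n) ord0 i) : Bn * Bn -> Rm).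
    exact: (measurableT_comp (@measurable_coord R n i)).
  have h2 i : measurable_fun [set: Bn * Bn] ((fun z => (z.2 : 'rV[R]_n) ord0 i) : Bn * Bn -> Rm).
    exact: (measurableT_comp (@measurable_coord R n i)).
  apply: measurable_fun_pair; apply: measurable_rowP => i; under eq_fun do rewrite !mxE.
    by apply: measurable_funD; apply: measurable_funM => //; [exact: h1|exact: h2].
  by apply: measurable_funD; apply: measurable_funM => //; [exact: h1|exact: h2].
have mF' : measurable_fun [set: Bn * Bn] F' by exact: measurableT_comp mF mrot.
rewrite -[LHS](@ge0_integral_law2 F')//; last by move=> z; exact: F0.
apply: eq_integral => z _; rewrite /F' /G /rotk row_mxKl row_mxKr/=.
by congr (F (_, _)); apply/rowP => i; rewrite !mxE ltn_ord.
Qed.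

End doubling.

(** * The law of a linear form of a Gaussian vector *)

Section marginal.
Context {R : realType}.
Notation Rm := (measurableTypeR R).
Notation gam := (normal_prob (0 : R) 1).

Lemma dotC n (x y : 'rV[R]_n) : dot x y = dot y x.
Proof. by apply: eq_bigr => i _; rewrite mulrC. Qed.

Lemma dotDl n (x y z : 'rV[R]_n) : dot (x + y) z = dot x z + dot y z.
Proof. by rewrite /dot -big_split/=; apply: eq_bigr => i _; rewrite mxE mulrDl. Qed.

Lemma dotZl n (a : R) (x z : 'rV[R]_n) : dot (a *: x) z = a * dot x z.
Proof. by rewrite /dot mulr_sumr; apply: eq_bigr => i _; rewrite mxE mulrA. Qed.

Lemma dot_ge0 n (x : 'rV[R]_n) : 0 <= dot x x.
Proof. by apply: sumr_ge0 => i _; rewrite -expr2 sqr_ge0. Qed.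

Lemma enorm_sqr n (x : 'rV[R]_n) : enorm x ^+ 2 = dot x x.
Proof. by rewrite sqr_sqrtr// dot_ge0. Qed.

Lemma enorm_ge0 n (x : 'rV[R]_n) : 0 <= enorm x.
Proof. exact: sqrtr_ge0. Qed.

Lemma measurable_dot n d (T : measurableType d) (f g : T -> borel_rV R n) :
  measurable_fun [set: T] f -> measurable_fun [set: T] g ->
  measurable_fun [set: T] ((fun t => dot (f t) (g t)) : T -> Rm).
Proof.
move=> mf mg; apply: measurable_sum => i; apply: measurable_funM.
  exact: (measurableT_comp (@measurable_coord R n i) mf).
exact: (measurableT_comp (@measurable_coord R n i) mg).
Qed.

Lemma integral_coord n (Q : probability (borel_rV R n) R) (i : 'I_n) (F : Rm -> \bar R) :
  gauss_law Q -> measurable_fun [set: Rm] F -> (forall u, 0 <= F u)%E ->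
  (\int[Q]_y F ((y : 'rV[R]_n) ord0 i) = \int[gam]_u F u)%E.
Proof.
move=> QG mF F0.
pose pr (y : borel_rV R n) : Rm := (y : 'rV[R]_n) ord0 i.
have mpr : measurable_fun [set: borel_rV R n] pr by exact: measurable_coord.
transitivity (\int[pushforward Q pr]_u F u)%E.
  by rewrite ge0_integral_pushforward.
apply: eq_measure_integral => A mA _.
change (Q (pr @^-1` A) = gam A).
have -> : pr @^-1` A = box (fun k => if k == i then A else setT).
  apply/seteqP; split => [x Ax k|x /(_ i)/=]; last by rewrite eqxx.
  by case: eqVneq => // ->.
rewrite QG; last by move=> k; case: ifP.
rewrite (bigD1 i)//= eqxx big1 ?mule1// => k /negbTE ->.
exact: (@probability_setT _ _ _ gam).
Qed.

(* Givens rotations kill the coordinates of [v] one after the other. *)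
Lemma integral_normr_dot n (Q : probability (borel_rV R n) R) (v : 'rV[R]_n)
    (F : Rm -> \bar R) :
  gauss_law Q -> measurable_fun [set: Rm] F -> (forall u, 0 <= F u)%E ->
  (\int[Q]_y F `|dot v y|%R = \int[gam]_u F (enorm v * `|u|)%R)%E.
Proof.
move=> QG mF F0.
have [m] := ubnP #|[pred i | v ord0 i != 0]|; elim: m v => // m IH v vm.
have [vs|] := leqP #|[pred i | v ord0 i != 0]| 1.
  have [v0|/existsP[i vi]] := boolP ([forall i, v ord0 i == 0]).
    have d0 y : dot v y = 0.
      by rewrite /dot big1// => i _; rewrite (eqP (forallP v0 i)) mul0r.
    rewrite /enorm d0 sqrtr0.
    under eq_integral do rewrite d0 normr0.
    under [RHS]eq_integral do rewrite mul0r.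
    rewrite integral_cst//= probability_setT mule1.
    rewrite integral_cst//=.
    by rewrite [X in (_ * X)%E](@probability_setT _ _ _ gam) mule1.
  have vk k : k != i -> v ord0 k = 0.
    move=> ki; apply/eqP/negP => /negP vk.
    by move: ki; rewrite (card_le1_eqP vs i k) ?eqxx.
  have dE y : dot v y = v ord0 i * y ord0 i.
    by rewrite /dot (bigD1 i)//= big1 ?addr0// => k ki; rewrite vk// mul0r.
  (* One nonzero coordinate is left. It may be negative, which the absolute value around the linear
     form absorbs. *)
  rewrite /enorm dE -expr2 sqrtr_sqr.
  under eq_integral do rewrite dE normrM.
  apply: (@integral_coord n Q i (fun u => F (`|v ord0 i| * `|u|))) => //.
  by apply: measurableT_comp => //; apply: measurable_funM => //; exact: measurableT_comp.
move=> /card_gt1P[i [j []]]; rewrite !inE => vi vj ij.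
pose r := Num.sqrt (v ord0 i ^+ 2 + v ord0 j ^+ 2).
have r2 : r ^+ 2 = v ord0 i ^+ 2 + v ord0 j ^+ 2 by rewrite sqr_sqrtr// addr_ge0// sqr_ge0.
have r0 : 0 < r by rewrite sqrtr_gt0 ltr_wpDr ?sqr_ge0// exprn_even_gt0.
(* This rotation replaces the pair of coordinates [i], [j] of [v] by (r, 0); it is not the half-turn
   because coordinate [j] is nonzero. *)
pose c := v ord0 i / r; pose s := - (v ord0 j / r).
have cs : c ^+ 2 + s ^+ 2 = 1.
  by rewrite /c /s sqrrN !expr_div_n -mulrDl -r2 divff// expf_neq0// gt_eqF.
have c1 : c != -1.
  apply/eqP => cE; move: cs; rewrite cE sqrrN expr1n => cs.
  have /eqP : s ^+ 2 = 0 by lra.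
  by rewrite sqrf_eq0 /s oppr_eq0 mulf_eq0 (negbTE vj)/= invr_eq0 gt_eqF.
pose v' : 'rV[R]_n := \row_k (if k == i then r else if k == j then 0 else v ord0 k).
have ji : (j == i) = false by rewrite eq_sym (negbTE ij).
have dv (w : 'rV[R]_n) : dot v (givens i j c s w) = dot v' w.
  rewrite /dot (bigD1 i)//= [RHS](bigD1 i)//= (bigD1 j) ?ji//= [in RHS](bigD1 j) ?ji//=.
  rewrite !mxE !eqxx ji mul0r !addrA; congr (_ + _).
    rewrite addr0 /c /s.
    have r0' : r != 0 by rewrite gt_eqF.
    have -> : r * w ord0 i = (r ^+ 2 / r) * w ord0 i by rewrite expr2 mulfK.
    by rewrite r2; field.
  by apply: eq_bigr => k /andP[ki kj]; rewrite !mxE (negbTE ki) (negbTE kj).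
have vv : enorm v = enorm v'.
  rewrite /enorm; congr Num.sqrt; rewrite /dot (bigD1 i)//= [RHS](bigD1 i)//=.
  rewrite (bigD1 j) ?ji//= [in RHS](bigD1 j) ?ji//= !mxE !eqxx ji mul0r add0r addrA.
  rewrite -!expr2 r2; congr (_ + _).
  by apply: eq_bigr => k /andP[ki kj]; rewrite !mxE (negbTE ki) (negbTE kj).
rewrite vv -IH; last first.
  rewrite -ltnS; apply: leq_trans vm; rewrite ltnS; apply: proper_card.
  apply/properP; split.
    apply/fintype.subsetP => k; rewrite !inE mxE.
    by case: (eqVneq k i) => [->//|_]; case: (eqVneq k j) => // _; rewrite eqxx.
  by exists j; rewrite !inE ?mxE ?ji ?eqxx.
have mFd : measurable_fun [set: borel_rV R n] (fun y => F `|dot v y|).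
  apply: (measurableT_comp mF); apply: measurableT_comp => //.
  exact: measurable_dot.
rewrite -(ge0_integral_givens QG ij cs c1 mFd)//.
by apply: eq_integral => y _; rewrite dv.
Qed.

End marginal.

(** * Absolute moments of the standard normal law, from both sides *)

Section moments.
Context {R : realType}.
Notation Rm := (measurableTypeR R).
Notation gam := (normal_prob (0 : R) 1).
Notation leb := (@lebesgue_measure R).

Lemma measurable_normr_powR (s : R) : measurable_fun [set: Rm] (fun u : Rm => `|u| `^ s).
Proof.
have h : measurable_fun [set: R] ((fun x : R => x `^ s) \o (fun x : R => `|x|)).
  by apply: measurableT_comp => //; exact: measurable_powR.
exact: h.
Qed.

Definition gmom (s : R) : \bar R := (\int[gam]_u (`|u| `^ s)%:E)%E.

Lemma gmom_ge0 s : (0 <= gmom s)%E.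
Proof. by apply: integral_ge0 => u _; rewrite lee_fin powR_ge0. Qed.

(** Square e^(y/4) >= 1 + y/4 and use (1 + y/4)^2 - y = (1 - y/4)^2. *)
Lemma le_expR_half (y : R) : y <= expR (y / 2).
Proof.
have -> : y / 2 = y / 4 + y / 4 by lra.
rewrite expRD; have := expR_ge1Dx (y / 4); have := expR_gt0 (y / 4).
set e := expR _ => e0 h.
have [y4|y4] := lerP 0 (1 + y / 4); last by nra.
have := sqr_ge0 (1 - y / 4).
have : (1 + y / 4) * (1 + y / 4) <= e * e by apply: ler_pM.
nra.
Qed.

(** Raise y <= e^(y/2), at y = u^2/s, to the power s/2. The resulting weight e^(u^2/4) still has a
    finite Gaussian integral. *)
Lemma powR_le_expR (s u : R) : 0 < s -> `|u| `^ s <= s `^ (s / 2) * expR (u ^+ 2 / 4).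
Proof.
move=> s0.
have [->|u0] := eqVneq u 0.
  by rewrite normr0 powR0 ?gt_eqF// mulr_ge0// ?powR_ge0// expR_ge0.
have u2 : 0 < u ^+ 2 by rewrite exprn_even_gt0.
have -> : `|u| `^ s = (u ^+ 2) `^ (s / 2).
  by rewrite -real_normK ?num_real// -powR_mulrn ?normr_ge0// -powRrM; congr (_ `^ _); lra.
rewrite [X in X `^ _ <= _](_ : _ = s * (u ^+ 2 / s)); last by field; rewrite gt_eqF.
rewrite powRM ?divr_ge0 ?(ltW s0) ?(ltW u2)//; apply: ler_wpM2l; first exact: powR_ge0.
apply: (@le_trans _ _ (expR ((u ^+ 2 / s) / 2) `^ (s / 2))).
  have q0 : 0 <= u ^+ 2 / s by rewrite divr_ge0// ltW.
  by apply: ge0_ler_powR; rewrite ?nnegrE ?expR_ge0 ?le_expR_half//; lra.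
rewrite -expRM ler_expR.
have -> // : u ^+ 2 / 4 = u ^+ 2 / s / 2 * (s / 2) by field; rewrite gt_eqF.
Qed.

Lemma gmom_le (s : R) : 0 < s -> (gmom s <= (2 * s `^ (s / 2))%:E)%E.
Proof.
move=> s0.
have sq2 : Num.sqrt 2 != 0 :> R by rewrite gt_eqF// sqrtr_gt0.
have mexp : measurable_fun [set: Rm] (fun u : Rm => (expR (u ^+ 2 / 4))%:E).
  apply/measurable_EFinP; apply: measurableT_comp => //.
  by apply: measurable_funM => //; exact: measurable_funX.
have e4 : (\int[gam]_u (expR (u ^+ 2 / 4))%:E = (Num.sqrt 2)%:E)%E.
  rewrite ge0_integral_gauss//.
  (* Against the standard normal density, the weight e^(x^2/4) leaves e^(-x^2/4), which is
     [Num.sqrt 2] times the density of variance 2 up to the common normalization. *)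
  transitivity (\int[leb]_x ((Num.sqrt 2)%:E * (normal_pdf 0 (Num.sqrt 2) x)%:E))%E.
    apply: eq_integral => x _; rewrite -!EFinM; congr EFin.
    rewrite phiE normal_pdfE// /normal_peak /normal_fun subr0 sqr_sqrtr//.
    have -> : 2 * pi *+ 2 = 2 * (pi *+ 2) :> R by ring.
    have sp : Num.sqrt (pi *+ 2) != 0 :> R.
      by rewrite gt_eqF// sqrtr_gt0 mulrn_wgt0// pi_gt0.
    have -> : expR (- x ^+ 2 / (2 *+ 2)) = expR (x ^+ 2 / 4) * expR (- x ^+ 2 / 2).
      by rewrite -expRD; congr expR; field.
    by rewrite sqrtrM//; field; rewrite sq2 sp.
  rewrite ge0_integralZl//; first by rewrite integral_normal_pdf mule1.
  - by apply/measurable_EFinP; exact: measurable_normal_pdf.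
  - by move=> x _; rewrite lee_fin normal_pdf_ge0.
apply: (@le_trans _ _ (\int[gam]_u ((s `^ (s / 2))%:E * (expR (u ^+ 2 / 4))%:E))%E).
  apply: ge0_le_integral => //.
  - apply/measurable_EFinP; exact: measurable_normr_powR.
  - by apply: emeasurable_funM.
  - by move=> u _; rewrite -EFinM lee_fin powR_le_expR.
rewrite ge0_integralZl//; last by rewrite lee_fin powR_ge0.
rewrite e4 -EFinM lee_fin mulrC ler_wpM2r ?powR_ge0//.
by rewrite -(ler_pXn2r (n:=2)) ?nnegrE ?sqrtr_ge0// sqr_sqrtr//; lra.
Qed.

Lemma gmom_fin (s : R) : 0 < s -> gmom s \is a fin_num.
Proof. by move=> s0; rewrite ge0_fin_numE ?gmom_ge0// (le_lt_trans (gmom_le s0))// ltry. Qed.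

(** The integrand |u|^p e^(-u^2/2) peaks at sqrt p, so the integral is restricted to the unit
    interval starting there. On it |u|^p is at least p^(p/2), and the density is at least e^(-2)
    e^(-(p+1)) >= e^(-3p). *)
Lemma gmom_ge (p : R) : 2 <= p -> ((p `^ (p / 2) * expR (- (3 * p)))%:E <= gmom p)%E.
Proof.
move=> p2; pose a : R := Num.sqrt p.
have a0 : 0 <= a by exact: sqrtr_ge0.
have a2 : a ^+ 2 = p by rewrite sqr_sqrtr//; lra.
have pp : a `^ p = p `^ (p / 2).
  have -> : p `^ (p / 2) = (a ^+ 2) `^ (p / 2) by rewrite a2.
  by rewrite -powR_mulrn// -powRrM; congr (_ `^ _); lra.
rewrite /gmom ge0_integral_gauss//; last first.
  by apply/measurable_EFinP; exact: measurable_normr_powR.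
have mf : measurable_fun [set: Rm] (fun x : Rm => ((`|x| `^ p)%:E * (normal_pdf 0 1 x)%:E)%E).
  apply: emeasurable_funM; apply/measurable_EFinP; last exact: measurable_normal_pdf.
  exact: measurable_normr_powR.
apply: (@le_trans _ _ (\int[leb]_(x in `[a, (a + 1)%R]) (p `^ (p / 2) * expR (- (3 * p)))%:E)%E).
  rewrite integral_cst//= lebesgue_measure_itv/= lte_fin ltrDl ltr01.
  by rewrite -EFinB addrAC subrr add0r mule1.
apply: (@le_trans _ _ (\int[leb]_(x in `[a, (a + 1)%R]) ((`|x| `^ p)%:E * (normal_pdf 0 1 x)%:E))%E); last first.
  apply: ge0_subset_integral => //.
  by move=> x _; rewrite mule_ge0// lee_fin ?powR_ge0 ?normal_pdf_ge0.
apply: ge0_le_integral => //.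
- by move=> x _; rewrite lee_fin mulr_ge0// ?powR_ge0 ?expR_ge0.
- exact: measurable_funTS.
move=> x /=; rewrite in_itv/= => /andP[ax xa1].
have x0 : 0 <= x by lra.
rewrite -EFinM lee_fin -pp; apply: ler_pM; rewrite ?powR_ge0 ?expR_ge0//.
  by rewrite ger0_norm// ge0_ler_powR ?nnegrE//; lra.
rewrite phiE.
have s3 : Num.sqrt (pi *+ 2) <= expR 2 :> R.
  rewrite -(ler_pXn2r (n:=2)) ?nnegrE ?sqrtr_ge0 ?expR_ge0// sqr_sqrtr; last first.
    by rewrite mulrn_wge0// pi_ge0.
  have := expR_ge1Dx (2 : R); have := @pihalf_lt2 R; nra.
apply: (@le_trans _ _ (expR (- 2) * expR (- (p + 1)))).
  by rewrite -expRD ler_expR; lra.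
apply: ler_pM; rewrite ?expR_ge0//.
  by rewrite expRN lef_pV2// ?posrE ?expR_gt0// sqrtr_gt0 mulrn_wgt0// pi_gt0.
(* (a + 1)^2 <= 2 a^2 + 2, hence x^2/2 <= p + 1. *)
have x2 : x * x <= (a + 1) * (a + 1) by apply: ler_pM.
by have := sqr_ge0 (a - 1); rewrite ler_expR !expr2 in a2 *; lra.
Qed.

End moments.

(** * Tangent inequalities for powers, and the estimates for sine and cosine *)

Section elementary.
Context {R : realType}.

Lemma sin_le_id (x : R) : 0 <= x -> sin x <= x.
Proof.
rewrite le_eqVlt => /predU1P[<-|x0]; first by rewrite sin0.
have [|c _] := @MVT R sin cos 0 x x0 (fun y _ => is_derive_sin y).
  by apply: continuous_subspaceT => y; exact: continuous_sin.
by rewrite sin0 !subr0 => ->; rewrite ler_piMl ?cos_le1// ltW.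
Qed.

Lemma one_minus_cos_le (x : R) : 0 <= x <= pi -> 1 - cos x <= x ^+ 2 / 2.
Proof.
move=> /andP[x0 xpi].
have x2 : 0 <= x / 2 by lra.
have s0 : 0 <= sin (x / 2) by apply: sin_ge0_pi; apply/andP; split; lra.
have := sin_le_id x2; have := sin2cos2 (x / 2); have := cos_mulr2n (x / 2).
have -> : x / 2 *+ 2 = x by rewrite mulr2n; lra.
move=> -> h1 h2.
have : sin (x / 2) ^+ 2 <= (x / 2) ^+ 2 by rewrite ler_pXn2r.
have -> : (x / 2) ^+ 2 = x ^+ 2 / 4 by field.
by move=> h; rewrite mulr2n; lra.
Qed.

(* The derivative of [|u| ^ s], in a form that is manifestly measurable. *)
Definition dpow (s u : R) : R := s * (`|u| `^ (s - 2) * u).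

Lemma powR_sub2 (s u : R) : 2 <= s -> `|u| `^ (s - 2) * u ^+ 2 = `|u| `^ s.
Proof.
move=> s2; have [->|u0] := eqVneq u 0.
  by rewrite normr0 expr0n mulr0 powR0// gt_eqF//; lra.
rewrite -real_normK ?num_real// -powR_mulrn// -powRD.
  by congr (_ `^ _); ring.
by rewrite normr_eq0 u0 implybT.
Qed.

Lemma dpow_mul (s u : R) : 2 <= s -> dpow s u * u = s * `|u| `^ s.
Proof. by move=> s2; rewrite -(powR_sub2 u s2) /dpow; ring. Qed.

Lemma normr_dpow (s u : R) : 2 <= s -> `|dpow s u| = s * `|u| `^ (s - 1).
Proof.
move=> s2; rewrite /dpow normrM ger0_norm; last by lra.
rewrite normrM (ger0_norm (powR_ge0 _ _)); congr (_ * _).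
have [->|u0] := eqVneq u 0.
  by rewrite normr0 mulr0 powR0// gt_eqF//; lra.
rewrite -[X in _ * X]powRr1// -powRD; last by rewrite normr_eq0 u0 implybT.
by congr (_ `^ _); ring.
Qed.

Lemma dpow_sqr (s u : R) : 2 <= s -> dpow s u ^+ 2 = s ^+ 2 * `|u| `^ (2 * s - 2).
Proof.
move=> s2; rewrite -real_normK ?num_real// normr_dpow// exprMn; congr (_ * _).
by rewrite -powR_mulrn ?powR_ge0// -powRrM; congr (_ `^ _); ring.
Qed.

(** Young's inequality for b and a^(s-1), with conjugate exponents s and s/(s-1), is this tangent
    inequality after multiplication by s. *)
Lemma powR_tangent (s a b : R) : 1 < s -> 0 <= a -> 0 <= b ->
  a `^ s + s * a `^ (s - 1) * (b - a) <= b `^ s.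
Proof.
move=> s1 a0 b0.
have s0 : 0 < s by lra.
have q0 : 0 < s / (s - 1) by rewrite divr_gt0//; lra.
have sn0 : s != 0 by rewrite gt_eqF.
have s1n0 : s - 1 != 0 by rewrite gt_eqF// subr_gt0.
have pq : s^-1 + (s / (s - 1))^-1 = 1 by field; rewrite sn0 s1n0.
have := @conjugate_powR R b (a `^ (s - 1)) s (s / (s - 1)) b0 (powR_ge0 _ _) s0 q0 pq.
rewrite -powRrM mulrC [_ * (s / _)]mulrC divfK//.
have as1 : a `^ (s - 1) * a = a `^ s.
  have [->|an0] := eqVneq a 0; first by rewrite mulr0 powR0.
  rewrite -[X in _ * X]powRr1// -powRD; last by rewrite an0 implybT.
  by congr (_ `^ _); ring.
have -> : a `^ s / (s / (s - 1)) = (a `^ s * (s - 1)) / s by field; rewrite sn0 s1n0.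
rewrite -mulrDl ler_pdivlMr// => h.
have -> : s * a `^ (s - 1) * (b - a) = a `^ (s - 1) * b * s - s * (a `^ (s - 1) * a) by ring.
by rewrite as1; lra.
Qed.

(** Convexity of |u|^s with the tangent drawn at [a]. It reduces to absolute values, since
    [dpow s a] has the sign of [a]. *)
Lemma powR_norm_tangent (s a b : R) : 2 <= s ->
  `|a| `^ s - `|b| `^ s <= dpow s a * (a - b).
Proof.
move=> s2.
have := @powR_tangent s `|a| `|b|; rewrite !normr_ge0 => /(_ _ isT isT) h.
have {}h : `|a| `^ s + s * `|a| `^ (s - 1) * (`|b| - `|a|) <= `|b| `^ s by apply: h; lra.
suff : dpow s a * (b - a) <= s * `|a| `^ (s - 1) * (`|b| - `|a|) by lra.
rewrite [leLHS]mulrBr dpow_mul// [leRHS]mulrBr lerB//.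
  apply: (le_trans (ler_norm _)).
  by rewrite normrM normr_dpow.
rewrite -normr_dpow// -normrM dpow_mul// ger0_norm// mulr_ge0 ?powR_ge0//; lra.
Qed.

Lemma exprn_tangent (r : nat) (a b : R) : 0 <= a -> 0 <= b ->
  a ^+ r.+1 + r.+1%:R * a ^+ r * (b - a) <= b ^+ r.+1.
Proof.
move=> a0 b0; elim: r => [|r IH]; first by rewrite !expr1 expr0; lra.
have := ler_wpM2l b0 IH; rewrite -exprS => IH'.
apply: le_trans IH'.
rewrite -subr_ge0 (_ : _ - _ = r.+1%:R * a ^+ r * (b - a) ^+ 2).
  by rewrite mulr_ge0 ?sqr_ge0// mulr_ge0// exprn_ge0.
rewrite !exprS -[r.+2%:R]natr1; ring.
Qed.

(** Add up the tangent inequalities at the mean of the [b i]: the linear terms cancel. *)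
Lemma exprn_sum_le (r N : nat) (b : 'I_N -> R) : (forall i, 0 <= b i) ->
  (\sum_i b i) ^+ r.+1 <= N%:R ^+ r * \sum_i b i ^+ r.+1.
Proof.
move=> b0; have [N0|N0] := posnP N.
  by subst N; rewrite !big_ord0 expr0n/= mulr0.
pose m := (\sum_i b i) / N%:R.
have NR : (0 : R) < N%:R by rewrite ltr0n.
have m0 : 0 <= m by rewrite divr_ge0// sumr_ge0.
have : \sum_(i < N) (m ^+ r.+1 + r.+1%:R * m ^+ r * (b i - m)) <= \sum_i b i ^+ r.+1.
  by apply: ler_sum => i _; exact: exprn_tangent.
rewrite big_split/= -mulr_sumr sumrB !sumr_const card_ord.
have -> : \sum_i b i - m *+ N = 0 by rewrite -mulr_natr /m divfK ?gt_eqF// subrr.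
rewrite mulr0 addr0 => h.
apply: le_trans (ler_wpM2l (exprn_ge0 r (ltW NR)) h).
have -> : m ^+ r.+1 *+ N = N%:R * m ^+ r.+1 by rewrite mulr_natl.
by rewrite mulrA -exprSr -exprMn /m [N%:R * _]mulrC divfK// gt_eqF.
Qed.

Lemma exprD_le (r : nat) (a b : R) : 0 <= a -> 0 <= b ->
  (a + b) ^+ r.+1 <= 2 ^+ r * (a ^+ r.+1 + b ^+ r.+1).
Proof.
move=> a0 b0; have := @exprn_sum_le r 2 (fun i => if i == ord0 then a else b).
by rewrite !big_ord_recl !big_ord0/= !addr0; apply => i; case: ifP.
Qed.

End elementary.

(** * Integrability, parametric integrals and Jensen's inequality *)

Section integral_tools.
Context {R : realType} d (S : measurableType d).

Lemma bounded_integrable (nu : {finite_measure set S -> \bar R}) (f : S -> R) (M : R) :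
  measurable_fun [set: S] f -> (forall t, `|f t| <= M) ->
  nu.-integrable [set: S] (EFin \o f).
Proof.
move=> mf fM; apply: measurable_bounded_integrable => //.
  by rewrite ltey_eq fin_num_measure.
exists M; split; first exact: num_real.
by move=> x Mx t _ /=; apply: le_trans (fM t) (ltW Mx).
Qed.

Lemma measurable_fun_Rintegral d' (X : measurableType d')
    (nu : {finite_measure set S -> \bar R}) (f : X * S -> R) :
  measurable_fun [set: X * S] f ->
  measurable_fun [set: X] (fun x => \int[nu]_t f (x, t)).
Proof.
move=> mf; apply: (measurableT_comp (@fine_measurable R setT measurableT)).
have mF : measurable_fun [set: X * S] (EFin \o f) by apply/measurable_EFinP.
have -> : (fun x => \int[nu]_t (f (x, t))%:E)%E =
   ((fun x => \int[nu]_t ((EFin \o f)^\+ (x, t))) \-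
    (fun x => \int[nu]_t ((EFin \o f)^\- (x, t))))%E.
  apply/funext => x; rewrite integralE.
  by congr (_ - _)%E; apply: eq_integral => t _; rewrite ?funeposE ?funenegE.
apply: emeasurable_funB.
  have := @measurable_fun_fubini_tonelli_F _ _ X S R nu ((EFin \o f)^\+)%E.
  rewrite /fubini_F; apply => //; exact: measurable_funepos.
have := @measurable_fun_fubini_tonelli_F _ _ X S R nu ((EFin \o f)^\-)%E.
rewrite /fubini_F; apply => //; exact: measurable_funeneg.
Qed.

(* Integrate the tangent line inequality at the mean. *)
Lemma jensen_exprn (P : probability S R) (f : S -> R) (r : nat) :
  P.-integrable [set: S] (EFin \o f) ->
  ((`|\int[P]_t f t| ^+ r.+1)%:E <= \int[P]_t (`|f t| ^+ r.+1)%:E)%E.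
Proof.
move=> fi; have mf : measurable_fun [set: S] f by apply/measurable_EFinP; case/integrableP: fi.
have mnf : measurable_fun [set: S] (fun t => `|f t|) by apply: measurableT_comp.
have ni : P.-integrable [set: S] (EFin \o (fun t => `|f t|)) by exact: integrable_abse fi.
pose a := \int[P]_t `|f t|.
have a0 : 0 <= a by exact: Rintegral_ge0.
have aE : (\int[P]_t (`|f t|)%:E = a%:E)%E.
  by rewrite /a /Rintegral fineK//; exact: (integrable_fin_num _ ni).
apply: (@le_trans _ _ (a ^+ r.+1)%:E).
  by rewrite lee_fin ler_pXn2r ?nnegrE//; exact: le_normr_Rintegral.
have : (\int[P]_t ((r.+1%:R * a ^+ r) * `|f t|)%:E <=
   \int[P]_t ((`|f t| ^+ r.+1)%:E + (r%:R * a ^+ r.+1)%:E))%E.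
  apply: ge0_le_integral => //.
  - by move=> t _; rewrite lee_fin !mulr_ge0// exprn_ge0.
  - by apply/measurable_EFinP; apply: measurable_funM.
  - by apply: emeasurable_funD => //; apply/measurable_EFinP; exact: measurable_funX.
  - move=> t _; rewrite -EFinD lee_fin.
    have := @exprn_tangent R r a `|f t| a0 (normr_ge0 _).
    by rewrite mulrBr -[X in X * a ^+ r * a]natr1 -mulrA -exprSr mulrDl; lra.
under eq_integral do rewrite EFinM.
rewrite ge0_integralZl//; last 2 first.
- by apply/measurable_EFinP.
- by rewrite lee_fin mulr_ge0// exprn_ge0.
rewrite aE ge0_integralD//; last 2 first.
- by apply/measurable_EFinP; exact: measurable_funX.
- by move=> t _; rewrite lee_fin mulr_ge0// exprn_ge0.
rewrite integral_cst//= probability_setT mule1 -EFinM -mulrA -exprSr.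
rewrite -[r.+1%:R]natr1 mulrDl mul1r addrC EFinD leeD2rE//.
Qed.

End integral_tools.

(** * The functions A_s, their directional derivatives and the gradient bound *)

(* The isotropic measure is presented by a finite measure [nu] and a map [e] into the sphere,
   with the value 0 left to the points that do not count. *)
Section frame.
Context {R : realType} {n : nat}.
Notation Bn := (borel_rV R n).
Context d (S : measurableType d) (nu : {finite_measure set S -> \bar R}).
Context (e : S -> Bn).
Context (me : measurable_fun [set: S] e).
Context (e01 : forall t, enorm (e t) = 0 \/ enorm (e t) = 1).
Context (iso : forall x : 'rV[R]_n,
  (\int[nu]_t (dot x (e t) ^+ 2)%:E = (dot x x)%:E)%E).

(** This is the A_s of the overview, a p-th power of the norm for s = p. *)
Definition psum (s : R) (x : 'rV[R]_n) : R := \int[nu]_t (`|dot x (e t)| `^ s).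

(* [dpsum s x y] is the derivative of [psum s] at [x] in the direction [y]. *)
Definition dpsum (s : R) (x y : 'rV[R]_n) : R :=
  \int[nu]_t (dpow s (dot x (e t)) * dot y (e t)).

Lemma measurable_dote (x : 'rV[R]_n) : measurable_fun [set: S] (fun t => dot x (e t)).
Proof. exact: (@measurable_dot _ _ _ _ (fun=> x : Bn) e). Qed.

Lemma dot_le (x y : 'rV[R]_n) : dot y y <= 1 -> `|dot x y| <= enorm x.
Proof.
move=> y1; pose b := dot x y.
have : 0 <= dot (x + (- b) *: y) (x + (- b) *: y) by exact: dot_ge0.
rewrite dotDl dotZl [dot x (_ + _)]dotC [dot y (_ + _)]dotC !dotDl !dotZl [dot y x]dotC -/b.
rewrite -enorm_sqr => h.
rewrite -(ler_pXn2r (n:=2)) ?nnegrE ?normr_ge0 ?enorm_ge0// real_normK ?num_real//.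
by rewrite -/b; nra.
Qed.

Lemma dot_ee t : dot (e t) (e t) <= 1.
Proof. by rewrite -enorm_sqr; case: (e01 t) => ->; rewrite ?expr0n ?expr1n. Qed.

Lemma dote_le (x : 'rV[R]_n) t : `|dot x (e t)| <= enorm x.
Proof. exact/dot_le/dot_ee. Qed.

Lemma measurable_psum_fun (s : R) (x : 'rV[R]_n) :
  measurable_fun [set: S] (fun t => `|dot x (e t)| `^ s).
Proof.
have := measurableT_comp (@measurable_normr_powR R s) (measurable_dote x).
exact.
Qed.

Lemma psum_integrable (s : R) (x : 'rV[R]_n) : 0 <= s ->
  nu.-integrable [set: S] (EFin \o (fun t => `|dot x (e t)| `^ s)).
Proof.
move=> s0; apply: (@bounded_integrable _ _ _ _ _ (enorm x `^ s)).
  exact: measurable_psum_fun.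
move=> t; rewrite ger0_norm ?powR_ge0//.
by apply: ge0_ler_powR; rewrite ?nnegrE ?enorm_ge0 ?dote_le.
Qed.

Lemma EFin_psum (s : R) x : 0 <= s ->
  (psum s x)%:E = (\int[nu]_t (`|dot x (e t)| `^ s)%:E)%E.
Proof.
by move=> s0; rewrite /psum /Rintegral fineK//; exact: (integrable_fin_num _ (psum_integrable x s0)).
Qed.

Lemma psum_ge0 (s : R) x : 0 <= psum s x.
Proof. by apply: Rintegral_ge0 => t _; exact: powR_ge0. Qed.

Lemma measurable_dpow (s : R) : measurable_fun [set: R] (dpow s).
Proof.
apply: measurable_funM => //; apply: measurable_funM => //.
exact: measurable_normr_powR.
Qed.

Lemma measurable_dpow_dote (s : R) x : measurable_fun [set: S] (fun t => dpow s (dot x (e t))).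
Proof. exact: (measurableT_comp (measurable_dpow s) (measurable_dote x)). Qed.

Lemma dpow_bound (s : R) x t : 2 <= s -> `|dpow s (dot x (e t))| <= s * enorm x `^ (s - 1).
Proof.
move=> s2; rewrite normr_dpow//; apply: ler_wpM2l; first lra.
by apply: ge0_ler_powR; rewrite ?nnegrE ?enorm_ge0 ?dote_le//; lra.
Qed.

Lemma dpsum_integrable (s : R) x y : 2 <= s ->
  nu.-integrable [set: S] (EFin \o (fun t => dpow s (dot x (e t)) * dot y (e t))).
Proof.
move=> s2; apply: (@bounded_integrable _ _ _ _ _ (s * enorm x `^ (s - 1) * enorm y)).
  by apply: measurable_funM; [exact: measurable_dpow_dote|exact: measurable_dote].
by move=> t; rewrite normrM ler_pM// ?dpow_bound// dote_le.
Qed.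

Lemma dpsumD (s : R) x y z : 2 <= s -> dpsum s x (y + z) = dpsum s x y + dpsum s x z.
Proof.
move=> s2; rewrite /dpsum -RintegralD//; last 2 first.
  exact: dpsum_integrable.
  exact: dpsum_integrable.
by apply: eq_Rintegral => t _; rewrite dotDl mulrDr.
Qed.

Lemma dpsumZ (s : R) x a y : 2 <= s -> dpsum s x (a *: y) = a * dpsum s x y.
Proof.
move=> s2; rewrite /dpsum -RintegralZl//; last exact: dpsum_integrable.
by apply: eq_Rintegral => t _; rewrite dotZl mulrCA.
Qed.

Lemma dpsum_self (s : R) x : 2 <= s -> dpsum s x x = s * psum s x.
Proof.
move=> s2; rewrite /psum -RintegralZl//; last by apply: psum_integrable; lra.
by apply: eq_Rintegral => t _; rewrite dpow_mul.
Qed.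

Lemma psum_tangent (s : R) x y : 2 <= s -> psum s x - psum s y <= dpsum s x (x - y).
Proof.
move=> s2; have s0 : 0 <= s by lra.
rewrite /psum -RintegralB//; [|exact: psum_integrable..].
apply: le_Rintegral => //.
- have := integrableB measurableT (psum_integrable x s0) (psum_integrable y s0).
  exact.
- exact: dpsum_integrable.
- move=> t _; have -> : dot (x - y) (e t) = dot x (e t) - dot y (e t).
    by rewrite dotDl -scaleN1r dotZl mulN1r.
  exact: powR_norm_tangent.
Qed.

Definition dpsum_grad s x : 'rV[R]_n := \row_i dpsum s x (delta_mx ord0 i).

(** For fixed [x] this exhibits a linear form in [y], whose Gaussian moments depend only on the
    length of the gradient. *)
Lemma dpsum_dot (s : R) x y : 2 <= s -> dpsum s x y = dot (dpsum_grad s x) y.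
Proof.
move=> s2; rewrite [y in LHS]row_sum_delta.
have M : {morph dpsum s x : u v / u + v >-> u + v} by move=> u v; exact: dpsumD.
have Z : dpsum s x 0 = 0 by rewrite -(scale0r 0) dpsumZ// mul0r.
rewrite (big_morph _ M Z).
by apply: eq_bigr => i _; rewrite dpsumZ// mxE mulrC.
Qed.

(* By isotropy [y |-> (t |-> dot y (e t))] is an isometry into L^2(nu); the gradient is its
   adjoint applied to [t |-> dpow s (dot x (e t))]. *)
Lemma dpsum_grad_le (s : R) x : 2 <= s ->
  dot (dpsum_grad s x) (dpsum_grad s x) <= s ^+ 2 * psum (2 * s - 2) x.
Proof.
move=> s2; set v := dpsum_grad s x.
have s20 : 0 <= 2 * s - 2 by lra.
have iv : nu.-integrable [set: S] (EFin \o (fun t => dot v (e t) ^+ 2)).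
  apply: (@bounded_integrable _ _ _ _ _ (enorm v ^+ 2)).
    exact/measurable_funX/measurable_dote.
  by move=> t; rewrite ger0_norm ?sqr_ge0// -real_normK ?num_real// ler_pXn2r ?nnegrE ?enorm_ge0// dote_le.
have ip := psum_integrable x s20.
have ivE : \int[nu]_t (dot v (e t) ^+ 2) = dot v v by rewrite /Rintegral iso.
have i1 : nu.-integrable [set: S] (EFin \o (fun t => s ^+ 2 * `|dot x (e t)| `^ (2 * s - 2))).
  have := integrableZl measurableT (s ^+ 2) ip.
  exact.
have : 2 * dpsum s x v <= s ^+ 2 * psum (2 * s - 2) x + dot v v.
  have -> : s ^+ 2 * psum (2 * s - 2) x + dot v v =
      \int[nu]_t (s ^+ 2 * `|dot x (e t)| `^ (2 * s - 2) + dot v (e t) ^+ 2).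
    by rewrite RintegralD// RintegralZl// ivE.
  have -> : 2 * dpsum s x v = \int[nu]_t (2 * (dpow s (dot x (e t)) * dot v (e t))).
    by rewrite RintegralZl//; exact: dpsum_integrable.
  apply: le_Rintegral => //.
  - have := integrableZl measurableT 2 (dpsum_integrable x v s2); exact.
  - have := integrableD measurableT i1 iv; exact.
  - move=> t _; rewrite -dpow_sqr//.
    have := sqr_ge0 (dpow s (dot x (e t)) - dot v (e t)).
    by rewrite sqrrB; lra.
rewrite dpsum_dot// -/v; lra.
Qed.

End frame.

(** * Gaussian moments of A_s: the exact mean, and finiteness of all orders *)

Section gaussian_moments.
Context {R : realType} {n : nat}.
Notation Rm := (measurableTypeR R).
Notation Bn := (borel_rV R n).
Context d (S : measurableType d) (nu : {finite_measure set S -> \bar R}).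
Context (e : S -> Bn).
Context (me : measurable_fun [set: S] e).
Context (e01 : forall t, enorm (e t) = 0 \/ enorm (e t) = 1).
Context (iso : forall x : 'rV[R]_n,
  (\int[nu]_t (dot x (e t) ^+ 2)%:E = (dot x x)%:E)%E).
Context (Q : probability Bn R).
Context (QG : gauss_law Q).
Notation psum := (psum nu e).
Notation dpsum := (dpsum nu e).

Lemma measurable_psum_fun2 (s : R) :
  measurable_fun [set: Bn * S] (fun z => `|dot z.1 (e z.2)| `^ s).
Proof.
have h : measurable_fun [set: Bn * S] (fun z => dot z.1 (e z.2)).
  apply: (@measurable_dot R n _ _ (fun z : Bn * S => z.1) (fun z => e z.2)).
    exact: measurable_fst.
  exact: measurableT_comp.
have := measurableT_comp (@measurable_normr_powR R s) h.
exact.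
Qed.

Lemma measurable_psum (s : R) : measurable_fun [set: Bn] (psum s).
Proof. exact: measurable_fun_Rintegral (measurable_psum_fun2 s). Qed.

Lemma measurable_dpsum (s : R) : measurable_fun [set: Bn * Bn] (fun z => dpsum s z.1 z.2).
Proof.
pose f (z : (Bn * Bn) * S) := dpow s (dot z.1.1 (e z.2)) * dot z.1.2 (e z.2).
apply: (@measurable_fun_Rintegral _ _ _ _ _ nu f).
have m2 : measurable_fun [set: (Bn * Bn) * S] (fun z => e z.2) by exact: measurableT_comp.
have h1 : measurable_fun [set: (Bn * Bn) * S] (fun z => dot z.1.1 (e z.2)).
  apply: (@measurable_dot R n _ _ (fun z : (Bn * Bn) * S => z.1.1) (fun z => e z.2)) => //.
  exact: measurableT_comp.
have h2 : measurable_fun [set: (Bn * Bn) * S] (fun z => dot z.1.2 (e z.2)).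
  apply: (@measurable_dot R n _ _ (fun z : (Bn * Bn) * S => z.1.2) (fun z => e z.2)) => //.
  exact: measurableT_comp.
apply: measurable_funM; last exact: h2.
exact: (measurableT_comp (measurable_dpow s) h1).
Qed.

Lemma dot_delta (x : 'rV[R]_n) i : dot (delta_mx ord0 i) x = x ord0 i.
Proof.
rewrite /dot (bigD1 i)//= mxE !eqxx mul1r big1 ?addr0// => j ji.
by rewrite mxE (negbTE ji) andbF mul0r.
Qed.

(** The trace of the isotropy identity, obtained by summing it over the standard basis. *)
Lemma integral_enorm_sqr : (\int[nu]_t (enorm (e t) ^+ 2)%:E = n%:R%:E)%E.
Proof.
have -> : (fun t => (enorm (e t) ^+ 2)%:E) =
   (fun t => \sum_(i < n) (dot (delta_mx ord0 i) (e t) ^+ 2)%:E)%E.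
  apply/funext => t; rewrite enorm_sqr sumEFin; congr EFin.
  by apply: eq_bigr => i _; rewrite dot_delta expr2.
rewrite ge0_integral_sum//; last 2 first.
- by move=> i; apply/measurable_EFinP/measurable_funX/measurable_dote.
- by move=> i t _; rewrite lee_fin sqr_ge0.
under eq_bigr do rewrite iso dot_delta mxE !eqxx.
by rewrite sumEFin sumr_const card_ord.
Qed.

Lemma integral_dot_powR (s : R) (v : 'rV[R]_n) :
  (\int[Q]_x (`|dot x v| `^ s)%:E = (enorm v `^ s)%:E * gmom s)%E.
Proof.
have mF : measurable_fun [set: Rm] (fun u : Rm => (`|u| `^ s)%:E).
  by apply/measurable_EFinP; exact: measurable_normr_powR.
have := @integral_normr_dot R n Q v (fun u => (`|u| `^ s)%:E) QG mF.
move=> /(_ (fun u => _)) h.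
transitivity (\int[Q]_y (`| `|dot v y|%R| `^ s)%:E)%E.
  by apply: eq_integral => x _; rewrite normr_id dotC.
rewrite h => [|u]; last by rewrite lee_fin powR_ge0.
rewrite /gmom -ge0_integralZl//; last by rewrite lee_fin powR_ge0.
apply: eq_integral => u _.
by rewrite normrM normr_id (ger0_norm (enorm_ge0 _)) powRM ?enorm_ge0// EFinM.
Qed.

(** After Tonelli the inner integral is |e t|^s times the moment of order s, and |e t|^s = |e t|^2
    because |e t| is 0 or 1 and s > 0; the trace of isotropy gives the factor n. *)
Lemma integral_psum (s : R) : 0 < s -> (\int[Q]_x (psum s x)%:E = n%:R%:E * gmom s)%E.
Proof.
move=> s0.
under eq_integral do rewrite (EFin_psum nu me e01 _ (ltW s0)).
have mF : measurable_fun [set: Bn * S] (fun z => (`|dot z.1 (e z.2)| `^ s)%:E).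
  by apply/measurable_EFinP; exact: measurable_psum_fun2.
have := @fubini_tonelli _ _ Bn S R Q nu (fun z => (`|dot z.1 (e z.2)| `^ s)%:E) mF.
rewrite /fubini_F /fubini_G/= => ->; last by move=> z; rewrite lee_fin powR_ge0.
under eq_integral do rewrite integral_dot_powR.
rewrite -integral_enorm_sqr.
have mE : measurable_fun [set: S] (fun t => (enorm (e t) ^+ 2)%:E).
  apply/measurable_EFinP; under eq_fun do rewrite enorm_sqr.
  exact: (@measurable_dot R n _ _ e e).
rewrite -ge0_integralZr ?gmom_ge0//; last by move=> t _; rewrite lee_fin sqr_ge0.
apply: eq_integral => t _; case: (e01 t) => ->.
  by rewrite powR0 ?gt_eqF// expr0n.
by rewrite powR1 expr1n.
Qed.

(** Bound s - 2 of the s factors by |x| and integrate the remaining square by isotropy. *)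
Lemma psum_le_enorm (s : R) x : 2 <= s -> psum s x <= enorm x `^ s.
Proof.
move=> s2; rewrite -lee_fin (EFin_psum nu me e01) //; last lra.
have h : measurable_fun [set: S] (fun t => (dot x (e t) ^+ 2)%:E).
  by apply/measurable_EFinP/measurable_funX/measurable_dote.
apply: (@le_trans _ _ (\int[nu]_t ((enorm x `^ (s - 2))%:E * (dot x (e t) ^+ 2)%:E))%E).
  apply: ge0_le_integral => //.
  - by apply/measurable_EFinP; exact: measurable_psum_fun.
  - exact: emeasurable_funM.
  - move=> t _; rewrite -EFinM lee_fin -(powR_sub2 _ s2) ler_wpM2r ?sqr_ge0//.
    by apply: ge0_ler_powR; rewrite ?nnegrE ?enorm_ge0 ?dote_le//; lra.
rewrite ge0_integralZl//; last 2 first.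
- by move=> t _; rewrite lee_fin sqr_ge0.
- by rewrite lee_fin powR_ge0.
rewrite iso -EFinM lee_fin -enorm_sqr.
by rewrite -[X in _ * X ^+ 2]ger0_norm ?enorm_ge0// -[X in X `^ _ * _]ger0_norm ?enorm_ge0//
  real_normK ?num_real// powR_sub2// ger0_norm// enorm_ge0.
Qed.

(** Only finiteness matters here: it gives integrability, and it lets the error term of the
    discretized rotation tend to 0. *)
Lemma psum_moment_fin (s : R) (r : nat) : 2 <= s ->
  (\int[Q]_x (psum s x ^+ r)%:E < +oo)%E.
Proof.
move=> s2.
(* The exponent is rounded up to an even integer, so that the power of |x| is a power of a sum of
   squares and can be split over the coordinates. *)
have [k kE] : exists k : nat, s * r%:R <= (2 * k.+1)%:R.
  exists (Num.truncn (s * r%:R)).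
  have := truncnS_gt (s * r%:R); rewrite natrM; set N := (Num.truncn _).+1%:R => hN.
  have : 0 <= N by exact: ler0n.
  lra.
pose g (x : Bn) : R := 1 + n%:R ^+ k * \sum_(i < n) `|(x : 'rV[R]_n) ord0 i| `^ (2 * k.+1)%:R.
have mterm i : measurable_fun [set: Bn] (fun x : Bn => `|(x : 'rV[R]_n) ord0 i| `^ (2 * k.+1)%:R).
  have := measurableT_comp (@measurable_normr_powR R (2 * k.+1)%:R) (@measurable_coord R n i).
  exact.
apply: (@le_lt_trans _ _ (\int[Q]_x (g x)%:E)%E).
  apply: ge0_le_integral => //.
  - by move=> x _; rewrite lee_fin exprn_ge0// psum_ge0.
  - by apply/measurable_EFinP/measurable_funX; exact: measurable_psum.
  - apply/measurable_EFinP; apply: measurable_funD => //; apply: measurable_funM => //.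
    exact: measurable_sum.
  move=> x _; rewrite lee_fin.
  apply: (@le_trans _ _ (enorm x `^ (s * r%:R))).
    rewrite powRrM powR_mulrn ?powR_ge0//.
    by apply: lerXn2r; rewrite ?nnegrE ?powR_ge0 ?psum_ge0 ?psum_le_enorm.
  have [x1|x1] := lerP (enorm x) 1.
    apply: (@le_trans _ _ 1).
      have e1 : 1 `^ (s * r%:R) = 1 :> R by rewrite powR1.
      rewrite -[leRHS]e1; apply: ge0_ler_powR; rewrite ?nnegrE ?enorm_ge0//.
      by rewrite mulr_ge0//; lra.
    by rewrite lerDl mulr_ge0 ?exprn_ge0// sumr_ge0// => i _; exact: powR_ge0.
  apply: (@le_trans _ _ (enorm x `^ (2 * k.+1)%:R)); first exact/ler_powR/kE/ltW.
  rewrite powR_mulrn ?enorm_ge0// exprM enorm_sqr.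
  apply: (le_trans (exprn_sum_le _ _)) => [i|]; first by rewrite -expr2 sqr_ge0.
  rewrite ler_wpDl//; apply: ler_wpM2l; first exact: exprn_ge0.
  apply: ler_sum => i _; rewrite powR_mulrn// exprM real_normK ?num_real//.
rewrite /g; under eq_integral do rewrite EFinD.
rewrite ge0_integralD//; last 2 first.
- move=> x _; rewrite lee_fin mulr_ge0 ?exprn_ge0// sumr_ge0// => i _; exact: powR_ge0.
- by apply/measurable_EFinP; apply: measurable_funM => //; exact: measurable_sum.
rewrite integral_cst//= probability_setT mule1.
under eq_integral do rewrite EFinM.
rewrite ge0_integralZl//; last 2 first.
- by apply/measurable_EFinP; exact: measurable_sum.
- by move=> x _; rewrite lee_fin sumr_ge0// => i _; exact: powR_ge0.
under eq_integral do rewrite -sumEFin.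
rewrite ge0_integral_sum//; last by move=> i; apply/measurable_EFinP.
rewrite lte_add_pinfty ?ltry// lte_mul_pinfty//.
rewrite lte_sum_pinfty// => i _.
under eq_integral do rewrite -dot_delta dotC.
rewrite integral_dot_powR lte_mul_pinfty ?lee_fin ?powR_ge0//.
by rewrite ltey_eq gmom_fin// ltr0n.
Qed.

End gaussian_moments.

(** * From X to Y by small rotations *)

Section rotation_path.
Context {R : realType} {n : nat}.
Notation Rm := (measurableTypeR R).
Notation Bn := (borel_rV R n).
Context d (S : measurableType d) (nu : {finite_measure set S -> \bar R}).
Context (e : S -> Bn).
Context (me : measurable_fun [set: S] e).
Context (e01 : forall t, enorm (e t) = 0 \/ enorm (e t) = 1).
Context (iso : forall x : 'rV[R]_n,
  (\int[nu]_t (dot x (e t) ^+ 2)%:E = (dot x x)%:E)%E).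
Context (Q : probability Bn R).
Context (QG : gauss_law Q).
Notation psum := (psum nu e).
Notation dpsum := (dpsum nu e).

(* Bounds the increment of [psum s] along a rotation of cosine [c] and sine [t] by the
   tangent at one end, the radial part being [dpsum s x x = s * psum s x]. *)
Definition tstep (s c t : R) (z : Bn * Bn) : R :=
  (1 - c) * s * psum s z.1 + t * `|dpsum s z.1 z.2|.

Lemma tstep_ge0 (s c t : R) z : 2 <= s -> c <= 1 -> 0 <= t -> 0 <= tstep s c t z.
Proof.
move=> s2 c1 t0; rewrite addr_ge0// mulr_ge0// ?psum_ge0//.
by rewrite mulr_ge0//; lra.
Qed.

Lemma measurable_tstep (s c t : R) : measurable_fun [set: Bn * Bn] (tstep s c t).
Proof.
apply: measurable_funD; apply: measurable_funM => //.
  exact: (measurableT_comp (measurable_psum nu me s)).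
apply: measurableT_comp => //; exact: measurable_dpsum.
Qed.

(** An absolute value needs both signs: the tangent at [x] bounds the decrease, the tangent at the
    rotated point the increase. For the latter the displacement is rewritten in the rotated pair by
    means of c^2 + t^2 = 1. *)
Lemma psum_step (s c t : R) (x y : 'rV[R]_n) : 2 <= s -> c ^+ 2 + t ^+ 2 = 1 ->
  c <= 1 -> 0 <= t ->
  `|psum s x - psum s (c *: x - t *: y)| <=
  tstep s c t (x, y) + tstep s c t (c *: x - t *: y, t *: x + c *: y).
Proof.
move=> s2 ct c1 t0.
set x' := c *: x - t *: y; set y' := t *: x + c *: y.
have h1 : psum s x - psum s x' <= tstep s c t (x, y).
  apply: (le_trans (psum_tangent nu me e01 _ _ s2)).
  have -> : x - x' = (1 - c) *: x + t *: y.
    by apply/rowP => i; rewrite !mxE; ring.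
  rewrite (dpsumD nu me e01)// !(dpsumZ nu me e01)// (dpsum_self nu me e01)//.
  by rewrite /tstep /= mulrA lerD2l ler_wpM2l// ler_norm.
have h2 : psum s x' - psum s x <= tstep s c t (x', y').
  apply: (le_trans (psum_tangent nu me e01 _ _ s2)).
  have -> : x' - x = (1 - c) *: x' + (- t) *: y'.
    apply/rowP => i; rewrite !mxE.
    transitivity (c * x 0 i - t * y 0 i - (c ^+ 2 + t ^+ 2) * x 0 i); last by ring.
    by rewrite ct mul1r.
  rewrite (dpsumD nu me e01)// !(dpsumZ nu me e01)// (dpsum_self nu me e01)//.
  rewrite /tstep /= mulrA lerD2l mulNr -mulrN ler_wpM2l//.
  by rewrite -normrN ler_norm.
have t1 := @tstep_ge0 s c t (x, y) s2 c1 t0.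
have t2 := @tstep_ge0 s c t (x', y') s2 c1 t0.
move: h1 h2 t1 t2.
move: (tstep s c t (x, y)) (tstep s c t (x', y')) (psum s x) (psum s x') => A B u v *.
by rewrite ler_norml; apply/andP; split; lra.
Qed.

Definition rotx (h : R) (x y : 'rV[R]_n) (j : nat) : 'rV[R]_n :=
  cos (j%:R * h) *: x + sin (j%:R * h) *: y.
Definition roty (h : R) (x y : 'rV[R]_n) (j : nat) : 'rV[R]_n :=
  - sin (j%:R * h) *: x + cos (j%:R * h) *: y.

(** The path goes from [x] at angle 0 to [y] at angle π/2; the sum telescopes, and each increment is
    read backwards, as a rotation from [j.+1] to [j]. *)
Lemma psum_path (s : R) (h : R) N (x y : 'rV[R]_n) : 2 <= s -> 0 <= sin h -> N%:R * h = pi / 2 ->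
  `|psum s x - psum s y| <= \sum_(j < N)
    (tstep s (cos h) (sin h) (rotx h x y j.+1, roty h x y j.+1) +
     tstep s (cos h) (sin h) (rotx h x y j, roty h x y j)).
Proof.
move=> s2 sh Nh.
have -> : psum s x - psum s y = - \sum_(j < N) (psum s (rotx h x y j.+1) - psum s (rotx h x y j)).
  rewrite -(big_mkord xpredT (fun j => psum s (rotx h x y j.+1) - psum s (rotx h x y j))).
  rewrite telescope_sumr// opprB /rotx Nh mul0r cos0 sin0 cos_pihalf sin_pihalf.
  by rewrite !scale0r !scale1r addr0 add0r.
rewrite normrN; apply: le_trans (ler_norm_sum _ _ _) _.
apply: ler_sum => j _.
have cE : cos (j%:R * h) = cos (j.+1%:R * h) * cos h + sin (j.+1%:R * h) * sin h.
  by rewrite -cosB -[j.+1%:R]natr1; congr cos; ring.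
have sE : sin (j%:R * h) = sin (j.+1%:R * h) * cos h - cos (j.+1%:R * h) * sin h.
  by rewrite -sinB -[j.+1%:R]natr1; congr sin; ring.
have xE : rotx h x y j = cos h *: rotx h x y j.+1 - sin h *: roty h x y j.+1.
  by rewrite /rotx /roty cE sE; apply/rowP => i; rewrite !mxE; ring.
have yE : roty h x y j = sin h *: rotx h x y j.+1 + cos h *: roty h x y j.+1.
  by rewrite /rotx /roty cE sE; apply/rowP => i; rewrite !mxE; ring.
rewrite xE yE; by apply: psum_step; rewrite ?cos2Dsin2 ?cos_le1.
Qed.

Notation QQ := (Q \x Q)%E.

Lemma measurable_rotxy (h : R) j :
  measurable_fun [set: Bn * Bn] ((fun z => (rotx h z.1 z.2 j, roty h z.1 z.2 j)) : Bn * Bn -> Bn * Bn).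
Proof.
have h1 i : measurable_fun [set: Bn * Bn] ((fun z => (z.1 : 'rV[R]_n) ord0 i) : Bn * Bn -> Rm).
  exact: (measurableT_comp (@measurable_coord R n i)).
have h2 i : measurable_fun [set: Bn * Bn] ((fun z => (z.2 : 'rV[R]_n) ord0 i) : Bn * Bn -> Rm).
  exact: (measurableT_comp (@measurable_coord R n i)).
apply: measurable_fun_pair; apply: measurable_rowP => i; under eq_fun do rewrite !mxE.
  by apply: measurable_funD; apply: measurable_funM => //; [exact: h1|exact: h2].
by apply: measurable_funD; apply: measurable_funM => //; [exact: h1|exact: h2].
Qed.

Lemma integral_QQ (F : Bn * Bn -> \bar R) :
  measurable_fun [set: Bn * Bn] F -> (forall z, 0 <= F z)%E ->
  (\int[QQ]_z F z = \int[Q]_x \int[Q]_y F (x, y))%E.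
Proof. by move=> mF F0; rewrite fubini_tonelli1. Qed.

(** Rotation invariance of the pair; the nonnegative cosine, available on a quarter turn, excludes
    the half-turn. *)
Lemma integral_rot_tstep (s : R) (r : nat) (c t h : R) (j : nat) : 2 <= s -> c <= 1 -> 0 <= t ->
  0 <= cos (j%:R * h) ->
  (\int[QQ]_z (tstep s c t (rotx h z.1 z.2 j, roty h z.1 z.2 j) ^+ r)%:E =
   \int[QQ]_z (tstep s c t z ^+ r)%:E)%E.
Proof.
move=> s2 c1 t0 ch.
have mF : measurable_fun [set: Bn * Bn] (fun z => (tstep s c t z ^+ r)%:E).
  by apply/measurable_EFinP/measurable_funX; exact: measurable_tstep.
have F0 z : (0 <= (tstep s c t z ^+ r)%:E)%E by rewrite lee_fin exprn_ge0// tstep_ge0.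
rewrite (integral_QQ mF F0).
rewrite (integral_QQ (measurableT_comp mF (measurable_rotxy h j)) (fun=> F0 _)).
apply: (ge0_integral_gauss_rot QG _ _ mF F0); first by rewrite cos2Dsin2.
by apply/eqP => cE; rewrite cE in ch; lra.
Qed.

Lemma integral_tstep_le (s c t : R) (r : nat) : 2 <= s -> c <= 1 -> 0 <= t ->
  (\int[QQ]_z (tstep s c t z ^+ r.+1)%:E <=
   ((2 * ((1 - c) * s)) ^+ r.+1)%:E * \int[Q]_x (psum s x ^+ r.+1)%:E +
   ((2 * t) ^+ r.+1)%:E * \int[QQ]_z (`|dpsum s z.1 z.2| ^+ r.+1)%:E)%E.
Proof.
move=> s2 c1 t0.
have c0 : 0 <= (1 - c) * s by rewrite mulr_ge0//; lra.
have mp : measurable_fun [set: Bn * Bn] (fun z => (psum s z.1 ^+ r.+1)%:E).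
  apply/measurable_EFinP/measurable_funX.
  exact: (measurableT_comp (measurable_psum nu me s)).
have md : measurable_fun [set: Bn * Bn] (fun z => (`|dpsum s z.1 z.2| ^+ r.+1)%:E).
  apply/measurable_EFinP/measurable_funX; apply: measurableT_comp => //.
  exact: measurable_dpsum.
have p0 (z : Bn * Bn) : (0 <= (psum s z.1 ^+ r.+1)%:E)%E by rewrite lee_fin exprn_ge0// psum_ge0.
have d0 (z : Bn * Bn) : (0 <= (`|dpsum s z.1 z.2| ^+ r.+1)%:E)%E by rewrite lee_fin exprn_ge0.
have -> : (\int[Q]_x (psum s x ^+ r.+1)%:E = \int[QQ]_z (psum s z.1 ^+ r.+1)%:E)%E.
  rewrite fubini_tonelli1//; apply: eq_integral => x _.
  by rewrite /fubini_F/= integral_cst//= probability_setT mule1.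
have k1 : (0 <= ((2 * ((1 - c) * s)) ^+ r.+1)%:E)%E by rewrite lee_fin exprn_ge0// mulr_ge0.
have k2 : (0 <= ((2 * t) ^+ r.+1)%:E)%E by rewrite lee_fin exprn_ge0// mulr_ge0.
rewrite -!ge0_integralZl// -ge0_integralD//; first last.
- exact: emeasurable_funM.
- by move=> z _; exact: mule_ge0.
- exact: emeasurable_funM.
- by move=> z _; exact: mule_ge0.
apply: ge0_le_integral => //.
- by move=> z _; rewrite lee_fin exprn_ge0// tstep_ge0.
- by apply/measurable_EFinP/measurable_funX; exact: measurable_tstep.
- by apply: emeasurable_funD; exact: emeasurable_funM.
move=> z _; rewrite -!EFinM -EFinD lee_fin -!exprMn.
have ha : 0 <= (1 - c) * s * psum s z.1 by rewrite mulr_ge0// psum_ge0.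
have hb : 0 <= t * `|dpsum s z.1 z.2| by rewrite mulr_ge0.
apply: le_trans (exprD_le r ha hb) _.
rewrite -!mulrA ![(2 * _) ^+ _]exprMn -mulrDr.
apply: ler_wpM2r; first by rewrite addr_ge0// exprn_ge0// ?mulrA.
by rewrite exprS ler_peMl ?exprn_ge0//; lra.
Qed.

(** The 2N terms of the path have the same law, so the power mean inequality costs (2N)^(r+1) times
    one integral. Splitting [tstep] costs another 2^(r+1), and N sin h <= π/2 then produces
    (2π)^(r+1). The radial part is of second order in the step h = π/(2N) and keeps N^(-(r+1)), of
    which one factor 1/N is retained. *)
Lemma psum_diff_le (s : R) (r N : nat) : 2 <= s -> (0 < N)%N ->
  (\int[QQ]_z (`|psum s z.1 - psum s z.2| ^+ r.+1)%:E <=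
   ((s * pi ^+ 2 / 2) ^+ r.+1 / N%:R)%:E * \int[Q]_x (psum s x ^+ r.+1)%:E +
   ((2 * pi) ^+ r.+1)%:E * \int[QQ]_z (`|dpsum s z.1 z.2| ^+ r.+1)%:E)%E.
Proof.
move=> s2 N0.
have NR : (0 : R) < N%:R by rewrite ltr0n.
have N1 : (1 : R) <= N%:R by rewrite ler1n.
have pi0 := @pi_gt0 R.
pose h : R := pi / 2 / N%:R.
have Nh : N%:R * h = pi / 2 by rewrite /h mulrC divfK// gt_eqF.
have h0 : 0 < h by rewrite !divr_gt0.
have hpi : h <= pi / 2 by rewrite -Nh ler_peMl// ltW.
have sh : 0 <= sin h by apply: sin_ge0_pi; apply/andP; split; lra.
have ch : cos h <= 1 by exact: cos_le1.
pose T := tstep s (cos h) (sin h).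
have T0 z : 0 <= T z by exact: tstep_ge0.
pose Tj j (z : Bn * Bn) := T (rotx h z.1 z.2 j, roty h z.1 z.2 j).
have mTj j : measurable_fun [set: Bn * Bn] (fun z => (Tj j z ^+ r.+1)%:E).
  apply/measurable_EFinP/measurable_funX.
  exact: (measurableT_comp (measurable_tstep s (cos h) (sin h)) (measurable_rotxy h j)).
pose I := (\int[QQ]_z (T z ^+ r.+1)%:E)%E.
have Ij j : (j <= N)%N -> (\int[QQ]_z (Tj j z ^+ r.+1)%:E = I)%E.
  move=> jN; apply: integral_rot_tstep => //.
  have jh0 : 0 <= j%:R * h by rewrite mulr_ge0// ltW.
  have jhp : j%:R * h <= pi / 2 by rewrite -Nh ler_wpM2r ?ler_nat// ltW.
  by apply: cos_ge0_pihalf; apply/andP; split; lra.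
have I0 : (0 <= I)%E by apply: integral_ge0 => z _; rewrite lee_fin exprn_ge0.
pose K : R := N%:R ^+ r * 2 ^+ r.
have K0 : 0 <= K by rewrite mulr_ge0 ?exprn_ge0.
have Tj0 j z : 0 <= Tj j z by exact: T0.
have Tpath z : `|psum s z.1 - psum s z.2| <= \sum_(j < N) (Tj j.+1 z + Tj j z).
  exact: psum_path.
clearbody Tj.
have TjE j z : (0 <= (Tj j z ^+ r.+1)%:E)%E by rewrite lee_fin exprn_ge0.
have mTT j : measurable_fun [set: Bn * Bn] (fun z => (Tj j.+1 z ^+ r.+1)%:E + (Tj j z ^+ r.+1)%:E)%E.
  exact: emeasurable_funD.
have KE : (0 <= K%:E)%E by rewrite lee_fin.
have TT0 j z : (0 <= (Tj j.+1 z ^+ r.+1)%:E + (Tj j z ^+ r.+1)%:E)%E by exact: adde_ge0.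
apply: (@le_trans _ _ (\int[QQ]_z (\sum_(j < N)
    (K%:E * ((Tj j.+1 z ^+ r.+1)%:E + (Tj j z ^+ r.+1)%:E))))%E).
  apply: ge0_le_integral => //.
  - apply/measurable_EFinP/measurable_funX; apply: measurableT_comp => //.
    apply: measurable_funB; apply: (measurableT_comp (measurable_psum nu me s)) => //.
  - by apply: emeasurable_sum => j; apply: emeasurable_funM.
  move=> z _.
  under eq_bigr do rewrite -EFinD -EFinM.
  rewrite sumEFin lee_fin -mulr_sumr.
  apply: (@le_trans _ _ ((\sum_(j < N) (Tj j.+1 z + Tj j z)) ^+ r.+1)).
    by apply: lerXn2r; rewrite ?nnegrE// sumr_ge0// => j _; rewrite addr_ge0.
  apply: (le_trans (exprn_sum_le _ _)) => [j|]; first by rewrite addr_ge0.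
  rewrite /K -mulrA; apply: ler_wpM2l; first exact: exprn_ge0.
  by rewrite mulr_sumr; apply: ler_sum => j _; apply: exprD_le.
rewrite ge0_integral_sum//; first last.
- by move=> j z _; apply: mule_ge0.
- by move=> j; apply: emeasurable_funM.
have -> : (\sum_(j < N) \int[QQ]_z (K%:E * ((Tj j.+1 z ^+ r.+1)%:E + (Tj j z ^+ r.+1)%:E)) =
    \sum_(j < N) (K%:E * (I + I)))%E.
  apply: eq_bigr => j _; rewrite (ge0_integralZl _ _ (mTT j) (fun z _ => TT0 j z) KE)//.
  rewrite (ge0_integralD _ _ (fun z _ => TjE j.+1 z) (mTj _) (fun z _ => TjE j z) (mTj _))//.
  by rewrite !Ij// ltnW.
have -> : (\sum_(j < N) (K%:E * (I + I)) = ((2 * N%:R) ^+ r.+1)%:E * I)%E.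
  have -> : (I + I = 2%:E * I)%E.
    by have -> : 2%:E = (1%:E + 1%:E)%E :> \bar R; [rewrite -EFinD|rewrite ge0_muleDl ?mul1e// lee_fin].
  under eq_bigr do rewrite muleA -EFinM.
  rewrite -ge0_sume_distrl; last by move=> j _; rewrite lee_fin mulr_ge0.
  rewrite sumEFin sumr_const card_ord; congr (_%:E * _)%E.
  have -> : K * 2 *+ N = N%:R * (K * 2) by rewrite mulr_natl.
  by rewrite /K exprMn !exprS; ring.
apply: (@le_trans _ _ (((2 * N%:R) ^+ r.+1)%:E *
   (((2 * ((1 - cos h) * s)) ^+ r.+1)%:E * \int[Q]_x (psum s x ^+ r.+1)%:E +
   ((2 * sin h) ^+ r.+1)%:E * \int[QQ]_z (`|dpsum s z.1 z.2| ^+ r.+1)%:E))%E).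
  apply: lee_wpmul2l; first by rewrite lee_fin exprn_ge0// mulr_ge0.
  exact: integral_tstep_le.
have EA0 : (0 <= \int[Q]_x (psum s x ^+ r.+1)%:E)%E.
  by apply: integral_ge0 => x _; rewrite lee_fin exprn_ge0// psum_ge0.
have EH0 : (0 <= \int[QQ]_z (`|dpsum s z.1 z.2| ^+ r.+1)%:E)%E.
  by apply: integral_ge0 => x _; rewrite lee_fin exprn_ge0.
have c0 : 0 <= (1 - cos h) * s by rewrite mulr_ge0//; lra.
rewrite ge0_muleDr; [|by rewrite mule_ge0// lee_fin exprn_ge0// mulr_ge0..].
rewrite !muleA -!EFinM -!exprMn.
apply: leeD; apply: lee_wpmul2r => //; rewrite lee_fin.
- have ch2 : 1 - cos h <= h ^+ 2 / 2.
    by apply: one_minus_cos_le; apply/andP; split; lra.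
  apply: (@le_trans _ _ ((s * pi ^+ 2 / 2 / N%:R) ^+ r.+1)).
    have s0 : 0 <= s by lra.
    have s1 : 0 <= s * pi ^+ 2 / 2 by apply: divr_ge0 => //; apply: mulr_ge0 => //; exact: sqr_ge0.
    apply: lerXn2r; rewrite ?nnegrE; [|exact: divr_ge0|].
      by apply: mulr_ge0; apply: mulr_ge0.
    have -> : 2 * N%:R * (2 * ((1 - cos h) * s)) = (4 * N%:R * s) * (1 - cos h) by ring.
    have -> : s * pi ^+ 2 / 2 / N%:R = (4 * N%:R * s) * (h ^+ 2 / 2).
      by rewrite /h; field; rewrite gt_eqF.
    by apply: ler_wpM2l => //; rewrite !mulr_ge0.
  rewrite expr_div_n ler_wpM2l//.
    apply/exprn_ge0/divr_ge0 => //; apply: mulr_ge0; [lra|exact: sqr_ge0].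
  by rewrite lef_pV2 ?posrE ?exprn_gt0// exprS ler_peMr// exprn_ege1.
- apply: lerXn2r; rewrite ?nnegrE; first by rewrite !mulr_ge0.
    by rewrite mulr_ge0// ltW.
  have -> : 2 * pi = 4 * (N%:R * h) :> R by rewrite Nh; field.
  have -> : 2 * N%:R * (2 * sin h) = 4 * (N%:R * sin h) by ring.
  by rewrite ler_wpM2l// ler_wpM2l// sin_le_id// ltW.
Qed.

(* As the number [N] of steps grows, the first term of [psum_diff_le] disappears. *)
Lemma psum_diff_moment (s : R) (r : nat) : 2 <= s ->
  (\int[QQ]_z (`|psum s z.1 - psum s z.2| ^+ r.+1)%:E <=
   ((2 * pi) ^+ r.+1)%:E * \int[QQ]_z (`|dpsum s z.1 z.2| ^+ r.+1)%:E)%E.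
Proof.
move=> s2.
have EA0 : (0 <= \int[Q]_x (psum s x ^+ r.+1)%:E)%E.
  by apply: integral_ge0 => x _; rewrite lee_fin exprn_ge0// psum_ge0.
have EAf : (\int[Q]_x (psum s x ^+ r.+1)%:E)%E \is a fin_num.
  by rewrite ge0_fin_numE//; exact: psum_moment_fin.
apply/lee_addgt0Pr => eps eps0.
pose a := fine (\int[Q]_x (psum s x ^+ r.+1)%:E)%E.
have aE : (\int[Q]_x (psum s x ^+ r.+1)%:E = a%:E)%E by rewrite fineK.
have a0 : 0 <= a by rewrite fine_ge0.
pose B := (s * pi ^+ 2 / 2) ^+ r.+1.
have s0 : 0 <= s by lra.
have B0 : 0 <= B by apply/exprn_ge0/divr_ge0 => //; apply: mulr_ge0 => //; exact: sqr_ge0.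
pose N := (Num.truncn (B * a / eps)).+1.
have hN : B * a / eps < N%:R by exact: truncnS_gt.
apply: (le_trans (@psum_diff_le s r N s2 isT)).
rewrite aE addeC leeD2l// -EFinM lee_fin -/B.
have N0 : (0 : R) < N%:R by rewrite ltr0n.
by rewrite mulrAC ler_pdivrMr// [eps * _]mulrC -ler_pdivrMr// ltW.
Qed.

Lemma dpsum_moment (s : R) (k : nat) : 2 <= s ->
  (\int[QQ]_z (`|dpsum s z.1 z.2| ^+ (2 * k.+1))%:E <=
   gmom (2 * k.+1)%:R * ((s ^+ 2) ^+ k.+1)%:E *
     \int[Q]_x (psum (2 * s - 2) x ^+ k.+1)%:E)%E.
Proof.
move=> s2.
have md : measurable_fun [set: Bn * Bn] (fun z => (`|dpsum s z.1 z.2| ^+ (2 * k.+1))%:E).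
  apply/measurable_EFinP/measurable_funX; apply: measurableT_comp => //.
  exact: measurable_dpsum.
have mp : measurable_fun [set: Bn] (fun x => (psum (2 * s - 2) x ^+ k.+1)%:E).
  by apply/measurable_EFinP/measurable_funX; exact: (measurable_psum nu me).
have p0 x : (0 <= (psum (2 * s - 2) x ^+ k.+1)%:E)%E by rewrite lee_fin exprn_ge0// psum_ge0.
rewrite integral_QQ//=.
have g0 : (0 <= gmom (2 * k.+1)%:R * ((s ^+ 2) ^+ k.+1)%:E :> \bar R)%E.
  by rewrite mule_ge0 ?gmom_ge0// lee_fin exprn_ge0// sqr_ge0.
rewrite -ge0_integralZl//.
apply: ge0_le_integral => //.
- by move=> x _; apply: integral_ge0 => y _; rewrite lee_fin exprn_ge0.
- have := @measurable_fun_fubini_tonelli_F _ _ Bn Bn R Q (fun z => (`|dpsum s z.1 z.2| ^+ (2 * k.+1))%:E).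
  by rewrite /fubini_F; apply => // z; rewrite lee_fin exprn_ge0.
- exact: emeasurable_funM.
move=> x _; set v := dpsum_grad nu e s x.
have -> : (\int[Q]_y (`|dpsum s x y| ^+ (2 * k.+1))%:E =
   \int[Q]_y (`|dot y v| `^ (2 * k.+1)%:R)%:E)%E.
  apply: eq_integral => y _; rewrite powR_mulrn// dotC /v.
  by rewrite (dpsum_dot nu me e01).
rewrite (integral_dot_powR QG) muleC -muleA; apply: lee_wpmul2l; first exact: gmom_ge0.
rewrite -EFinM lee_fin powR_mulrn ?enorm_ge0// exprM enorm_sqr -exprMn.
apply: lerXn2r; rewrite ?nnegrE ?dot_ge0//.
  by rewrite mulr_ge0 ?sqr_ge0// psum_ge0.
exact: dpsum_grad_le.
Qed.

End rotation_path.

(** * The recursion on moments *)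

Section recursion.
Context {R : realType} {n : nat}.
Notation Bn := (borel_rV R n).
Context d (S : measurableType d) (nu : {finite_measure set S -> \bar R}).
Context (e : S -> Bn).
Context (me : measurable_fun [set: S] e).
Context (e01 : forall t, enorm (e t) = 0 \/ enorm (e t) = 1).
Context (iso : forall x : 'rV[R]_n,
  (\int[nu]_t (dot x (e t) ^+ 2)%:E = (dot x x)%:E)%E).
Context (Q : probability Bn R).
Context (QG : gauss_law Q).
Notation psum := (psum nu e).

Notation QQ := (Q \x Q)%E.

Definition pmean (s : R) : R := \int[Q]_x psum s x.

Lemma psum_Q_integrable (s : R) : 2 <= s -> Q.-integrable [set: Bn] (EFin \o psum s).
Proof.
move=> s2; apply/integrableP; split.
  by apply/measurable_EFinP; exact: measurable_psum.
have := psum_moment_fin me e01 iso QG 1 s2.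
by under eq_integral do rewrite expr1 -[psum s _]ger0_norm ?psum_ge0// -abse_EFin.
Qed.

Lemma pmeanE (s : R) : 2 <= s -> (pmean s)%:E = (n%:R%:E * gmom s)%E.
Proof.
move=> s2; rewrite -(integral_psum me e01 iso QG); last lra.
by rewrite /pmean /Rintegral fineK//; exact: (integrable_fin_num _ (psum_Q_integrable s2)).
Qed.

Lemma pmean_ge0 (s : R) : 0 <= pmean s.
Proof. by apply: Rintegral_ge0 => x _; exact: psum_ge0. Qed.

Lemma pmean_le (s : R) : 2 <= s -> pmean s <= n%:R * (2 * s `^ (s / 2)).
Proof.
move=> s2; rewrite -lee_fin pmeanE// EFinM; apply: lee_wpmul2l; first by rewrite lee_fin.
by apply: gmom_le; lra.
Qed.

Lemma pmean_ge (s : R) : 2 <= s -> n%:R * (s `^ (s / 2) * expR (- (3 * s))) <= pmean s.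
Proof.
move=> s2; rewrite -lee_fin pmeanE// EFinM; apply: lee_wpmul2l; first by rewrite lee_fin.
exact: gmom_ge.
Qed.

(** For fixed [x] the centered value is the average over [y] of [psum s x - psum s y]; Jensen's
    inequality moves the power inside. *)
Lemma centered_le_diff (s : R) (r : nat) : 2 <= s ->
  (\int[Q]_x (`|psum s x - pmean s| ^+ r.+1)%:E <=
   \int[QQ]_z (`|psum s z.1 - psum s z.2| ^+ r.+1)%:E)%E.
Proof.
move=> s2.
have mp := measurable_psum nu me s.
have mpp : measurable_fun [set: Bn * Bn] (fun z => (`|psum s z.1 - psum s z.2| ^+ r.+1)%:E).
  apply/measurable_EFinP/measurable_funX; apply: measurableT_comp => //.
  by apply: measurable_funB; apply: (measurableT_comp mp).
rewrite integral_QQ//=.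
apply: ge0_le_integral => //.
- apply/measurable_EFinP/measurable_funX; apply: measurableT_comp => //.
  exact: measurable_funB.
- have := @measurable_fun_fubini_tonelli_F _ _ Bn Bn R Q (fun z => (`|psum s z.1 - psum s z.2| ^+ r.+1)%:E) mpp.
  by rewrite /fubini_F; apply => z; rewrite lee_fin exprn_ge0.
move=> x _.
have ci : Q.-integrable [set: Bn] (EFin \o (fun=> psum s x)) by exact: finite_measure_integrable_cst.
have cE : \int[Q]_y (psum s x) = psum s x.
  by rewrite /Rintegral integral_cst//= probability_setT mule1.
have -> : psum s x - pmean s = \int[Q]_y (psum s x - psum s y).
  by rewrite (RintegralB measurableT ci (psum_Q_integrable s2)) cE.
apply: jensen_exprn.
have := integrableB measurableT ci (psum_Q_integrable s2).
exact.
Qed.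

(** The constant: (2π s)^2 <= 64 s^2 since π < 4, and the factor 2 in the bound of the normal moment
    is at most 2^(k+1); together 2 * 64 = 2^7. *)
Lemma centered_moment (s : R) (k : nat) : 2 <= s ->
  (\int[Q]_x (`|psum s x - pmean s| ^+ (2 * k.+1))%:E <=
   ((2 ^+ 7 * s ^+ 2 * (2 * k.+1)%:R) ^+ k.+1)%:E *
   \int[Q]_x (psum (2 * s - 2) x ^+ k.+1)%:E)%E.
Proof.
move=> s2.
have E2 : (2 * k.+1 = (2 * k).+1.+1)%N by rewrite mulnS.
have E0 : (0 <= \int[Q]_x (psum (2 * s - 2) x ^+ k.+1)%:E)%E.
  by apply: integral_ge0 => x _; rewrite lee_fin exprn_ge0// psum_ge0.
rewrite [in leLHS]E2; apply: (le_trans (centered_le_diff _ s2)).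
apply: (le_trans (psum_diff_moment me e01 iso QG _ s2)).
rewrite -E2.
apply: (@le_trans _ _ (((2 * pi) ^+ (2 * k.+1))%:E * (gmom (2 * k.+1)%:R * ((s ^+ 2) ^+ k.+1)%:E *
     \int[Q]_x (psum (2 * s - 2) x ^+ k.+1)%:E))%E).
  apply: lee_wpmul2l; first by rewrite lee_fin exprn_ge0// mulr_ge0// pi_ge0.
  exact: dpsum_moment.
rewrite !muleA; apply: lee_wpmul2r => //.
rewrite muleAC -EFinM muleC.
have k0 : (0 : R) < (2 * k.+1)%:R by rewrite ltr0n.
apply: (le_trans (lee_wpmul2r _ (gmom_le k0))).
  by rewrite lee_fin mulr_ge0// exprn_ge0// ?sqr_ge0// mulr_ge0// pi_ge0.
rewrite -EFinM lee_fin.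
have -> : (2 * k.+1)%:R / 2 = k.+1%:R :> R by rewrite natrM; field.
rewrite powR_mulrn// exprM -exprMn -exprMn.
set q := (2 * pi * s) ^+ 2; set r : R := (2 * k.+1)%:R.
have q0 : 0 <= q by exact: sqr_ge0.
have q64 : q <= 64 * s ^+ 2.
  rewrite /q exprMn; apply: ler_wpM2r; first exact: sqr_ge0.
  by have := @pihalf_lt2 R; have := @pi_gt0 R; nra.
have -> : 2 * r ^+ k.+1 * q ^+ k.+1 = 2 * (r * q) ^+ k.+1 by rewrite [(r * q) ^+ _]exprMn mulrA.
apply: (@le_trans _ _ (2 ^+ k.+1 * (r * q) ^+ k.+1)).
  apply: ler_wpM2r; last by rewrite exprS ler_peMr// exprn_ege1//; lra.
  by rewrite exprn_ge0// mulr_ge0// ltW.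
rewrite -exprMn; apply: lerXn2r; rewrite ?nnegrE.
- by rewrite mulr_ge0// mulr_ge0// ltW.
- by rewrite mulr_ge0 ?(ltW k0)// mulr_ge0 ?sqr_ge0// exprn_ge0.
have -> : 2 ^+ 7 * s ^+ 2 * r = 2 * (r * (64 * s ^+ 2)) by ring.
by apply: ler_wpM2l => //; apply: ler_wpM2l => //; exact: ltW.
Qed.

(* [Phi] bounds the norm in L^k of [psum s], and [Psi] the square of the norm in L^r of
   [psum s - pmean s]. *)
Definition Phi (s : R) (k : nat) : R :=
  2 ^+ 11 * s `^ (s / 2 + 1) * (n%:R + (4 * k%:R) `^ (s / 2)).

Definition Psi (s : R) (r : nat) : R :=
  2 ^+ 18 * s `^ (s + 2) * (2 `^ s * r%:R * n%:R + (4 * r%:R) `^ s / 2).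

Lemma Phi_ge0 s k : 0 <= Phi s k.
Proof.
apply: mulr_ge0; last by rewrite addr_ge0 ?powR_ge0.
by apply: mulr_ge0; [exact: exprn_ge0|exact: powR_ge0].
Qed.

(** [Psi] is shaped by this product. At 2s - 2 the exponent s/2 + 1 becomes s, the bound (2s-2)^s <=
    2^s s^s brings in the factor 2^s, and 2^s (2k) (4k)^(s-1) equals (4 (2k))^s / 2. *)
Lemma Phi_le_Psi (s : R) (k : nat) : 2 <= s -> (0 < k)%N ->
  2 ^+ 7 * s ^+ 2 * (2 * k)%:R * Phi (2 * s - 2) k <= Psi s (2 * k).
Proof.
move=> s2 k0; rewrite /Phi /Psi.
have s0 : 0 < s by lra.
have kR : (0 : R) < k%:R by rewrite ltr0n.
have -> : (2 * s - 2) / 2 + 1 = s by field.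
have -> : (2 * s - 2) / 2 = s - 1 by field.
have h1 : (2 * s - 2) `^ s <= 2 `^ s * s `^ s.
  by rewrite -powRM ?(ltW s0)//; apply: ge0_ler_powR; rewrite ?nnegrE; lra.
have h2 : s ^+ 2 * s `^ s = s `^ (s + 2).
  by rewrite -powR_mulrn ?(ltW s0)// -powRD ?(gt_eqF s0) ?implybT// addrC.
have h3 : 2 `^ s * ((2 * k)%:R * (4 * k%:R) `^ (s - 1)) = (4 * (2 * k)%:R) `^ s / 2 :> R.
  rewrite natrM; set u : R := 4 * k%:R.
  have u0 : 0 < u by rewrite mulr_gt0.
  have -> : 4 * (2 * k%:R) = 2 * u by rewrite /u; ring.
  have -> : 2 * k%:R = u / 2 by rewrite /u; field.
  rewrite powRM ?(ltW u0)//.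
  have -> : u `^ s = u * u `^ (s - 1).
    rewrite -[X in X * _]powRr1 ?(ltW u0)// -powRD ?(gt_eqF u0) ?implybT//.
    by congr (_ `^ _); ring.
  by field.
set r : R := (2 * k)%:R in h3 *.
have r0 : 0 <= r by exact: ler0n.
rewrite -h3.
have -> : 2 ^+ 18 * s `^ (s + 2) * (2 `^ s * r * n%:R + 2 `^ s * (r * (4 * k%:R) `^ (s - 1))) =
   (2 ^+ 7 * 2 ^+ 11 * s ^+ 2 * r * (n%:R + (4 * k%:R) `^ (s - 1))) * (2 `^ s * s `^ s).
  by rewrite -h2; ring.
have -> : 2 ^+ 7 * s ^+ 2 * r * (2 ^+ 11 * (2 * s - 2) `^ s * (n%:R + (4 * k%:R) `^ (s - 1))) =
   (2 ^+ 7 * 2 ^+ 11 * s ^+ 2 * r * (n%:R + (4 * k%:R) `^ (s - 1))) * (2 * s - 2) `^ s by ring.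
apply: ler_wpM2l => //.
apply: mulr_ge0; last by rewrite addr_ge0 ?powR_ge0.
by apply: mulr_ge0 => //; apply: mulr_ge0 => //; exact: sqr_ge0.
Qed.

Lemma quad_ineq (N v w : R) : 0 <= N -> 0 <= w -> v * v <= w * w ->
  v * N + w * w / 2 <= (N + w) * (N + w).
Proof.
move=> N0 w0 h; have := sqr_ge0 (N - v / 2); have := mulr_ge0 N0 w0; nra.
Qed.

(** Since s >= 2 and r >= 1, 2^s r is at most w = (4r)^(s/2); the mixed term 2^s r n is then
    absorbed by the square of n + w. *)
Lemma Psi_le_sqr (s : R) (r : nat) : 2 <= s -> (0 < r)%N ->
  Psi s r <= (2 ^+ 9 * s `^ (s / 2 + 1) * (n%:R + (4 * r%:R) `^ (s / 2))) ^+ 2.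
Proof.
move=> s2 r0; have s0 : 0 < s by lra.
have r1 : (1 : R) <= r%:R by rewrite ler1n.
rewrite /Psi [(_ * _ * _) ^+ 2]exprMn [(2 ^+ 9 * _) ^+ 2]exprMn -exprM.
rewrite (_ : 9 * 2 = 18)%N//.
have -> : (s `^ (s / 2 + 1)) ^+ 2 = s `^ (s + 2).
  by rewrite -powR_mulrn ?powR_ge0// -powRrM; congr (_ `^ _); field.
apply: ler_wpM2l; first by rewrite mulr_ge0 ?powR_ge0// exprn_ge0.
set w := (4 * r%:R) `^ (s / 2).
have w0 : 0 <= w by exact: powR_ge0.
have w2 : (4 * r%:R) `^ s = w ^+ 2.
  by rewrite -powR_mulrn ?powR_ge0// -powRrM; congr (_ `^ _); field.
have h : (2 `^ s * r%:R) ^+ 2 <= w ^+ 2.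
  rewrite -w2 powRM// exprMn.
  have -> : (2 `^ s) ^+ 2 = 4 `^ s :> R.
    rewrite -powR_mulrn ?powR_ge0// -powRrM mulrC powRrM; congr (_ `^ _).
    by rewrite powR_mulrn//; ring.
  apply: ler_wpM2l; first exact: powR_ge0.
  by rewrite -powR_mulrn// ler_powR.
rewrite w2 ![_ ^+ 2]expr2; rewrite !expr2 in h.
exact: quad_ineq.
Qed.

(** Induction on [j] for all [s] at once, because s changes to 2s - 2. The constant 2^11 reproduces
    itself: the centered part has squared norm at most 2^7 * 2^11 = 2^18 times W^2, hence norm at
    most 2^9 W, and adding the mean, which is at most W, stays below 2^11 W. *)
Lemma psum_moment_le (j : nat) (s : R) : 2 <= s ->
  (\int[Q]_x (psum s x ^+ (2 ^ j)%N)%:E <= (Phi s (2 ^ j)%N ^+ (2 ^ j)%N)%:E)%E.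
Proof.
elim: j s => [|j IH] s s2; have s0 : 0 < s by lra.
  rewrite expn0 !expr1; under eq_integral do rewrite expr1.
  rewrite (integral_psum me e01 iso QG)// -pmeanE// lee_fin.
  apply: (le_trans (pmean_le s2)); rewrite /Phi.
  apply: (@le_trans _ _ (2 ^+ 11 * s `^ (s / 2 + 1) * n%:R)); last first.
    by rewrite ler_wpM2l ?mulr_ge0 ?powR_ge0// lerDl powR_ge0.
  rewrite powRD ?(gt_eqF s0) ?implybT// powRr1 ?(ltW s0)//.
  have -> : n%:R * (2 * s `^ (s / 2)) = 2 * (s `^ (s / 2) * n%:R) by ring.
  have -> : 2 ^+ 11 * (s `^ (s / 2) * s) * n%:R = (2 ^+ 11 * s) * (s `^ (s / 2) * n%:R) by ring.
  by rewrite ler_wpM2r ?mulr_ge0 ?powR_ge0//; lra.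
set k := (2 ^ j)%N; have k0 : (0 < k)%N by rewrite expn_gt0.
have [k' kE] : exists k', k = k'.+1 by exists k.-1; rewrite prednK.
have rE : (2 ^ j.+1 = 2 * k)%N by rewrite expnS.
rewrite rE.
have s22 : 2 <= 2 * s - 2 by lra.
pose W := s `^ (s / 2 + 1) * (n%:R + (4 * (2 * k)%:R) `^ (s / 2)).
have W0 : 0 <= W by rewrite mulr_ge0 ?powR_ge0// addr_ge0 ?powR_ge0.
have D : (\int[Q]_x (`|psum s x - pmean s| ^+ (2 * k))%:E <= ((2 ^+ 9 * W) ^+ (2 * k))%:E)%E.
  rewrite [in leLHS]kE; apply: (le_trans (centered_moment _ s2)); rewrite -kE.
  apply: (@le_trans _ _ (((2 ^+ 7 * s ^+ 2 * (2 * k)%:R) ^+ k)%:E * (Phi (2 * s - 2) k ^+ k)%:E)%E).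
    apply: lee_wpmul2l; first by rewrite lee_fin exprn_ge0// mulr_ge0// mulr_ge0// sqr_ge0.
    exact: IH.
  rewrite -EFinM lee_fin -exprMn exprM; apply: lerXn2r; rewrite ?nnegrE ?sqr_ge0//.
    by rewrite mulr_ge0 ?Phi_ge0// mulr_ge0// mulr_ge0// sqr_ge0.
  apply: (le_trans (Phi_le_Psi s2 k0)).
  by rewrite /W mulrA; apply: Psi_le_sqr => //; rewrite muln_gt0.
have mW : pmean s <= W.
  apply: (le_trans (pmean_le s2)); rewrite /W powRD ?(gt_eqF s0) ?implybT// powRr1 ?(ltW s0)//.
  have -> : n%:R * (2 * s `^ (s / 2)) = (s `^ (s / 2) * 2) * n%:R by ring.
  apply: ler_pM => //; first by rewrite mulr_ge0 ?powR_ge0.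
    by apply: ler_wpM2l => //; exact: powR_ge0.
  by rewrite lerDl powR_ge0.
have E2 : (2 * k = (2 * k).-1.+1)%N by rewrite prednK// muln_gt0.
have mD : measurable_fun [set: Bn] (fun x => (`|psum s x - pmean s| ^+ (2 * k))%:E).
  apply/measurable_EFinP/measurable_funX; apply: measurableT_comp => //.
  by apply: measurable_funB => //; exact: measurable_psum.
have D0 x : (0 <= (`|psum s x - pmean s| ^+ (2 * k))%:E)%E by rewrite lee_fin exprn_ge0.
have W20 : (0 <= (W ^+ (2 * k))%:E)%E by rewrite lee_fin exprn_ge0.
have mWD : measurable_fun [set: Bn] (fun x => (W ^+ (2 * k))%:E + (`|psum s x - pmean s| ^+ (2 * k))%:E)%E.
  exact: emeasurable_funD.
have WD0 x : (0 <= (W ^+ (2 * k))%:E + (`|psum s x - pmean s| ^+ (2 * k))%:E)%E by exact: adde_ge0.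
pose K : R := 2 ^+ (2 * k).-1.
have K0 : 0 <= K by exact: exprn_ge0.
apply: (@le_trans _ _ (\int[Q]_x (K%:E * ((W ^+ (2 * k))%:E + (`|psum s x - pmean s| ^+ (2 * k))%:E)))%E).
  apply: ge0_le_integral => //.
  - by move=> x _; rewrite lee_fin exprn_ge0// psum_ge0.
  - by apply/measurable_EFinP/measurable_funX; exact: measurable_psum.
  - by apply: emeasurable_funM => //; exact: emeasurable_funD.
  move=> x _; rewrite -EFinD -EFinM lee_fin.
  apply: (@le_trans _ _ ((W + `|psum s x - pmean s|) ^+ (2 * k))).
    apply: lerXn2r; rewrite ?nnegrE ?psum_ge0 ?addr_ge0//.
    by have := ler_norm (psum s x - pmean s); lra.
  by rewrite /K E2; apply: exprD_le.
rewrite ge0_integralZl// ge0_integralD//.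
rewrite integral_cst//= probability_setT mule1.
apply: (le_trans (lee_wpmul2l _ (leeD2l _ D))); first by rewrite lee_fin.
rewrite -EFinD -EFinM lee_fin.
have W512 : W ^+ (2 * k) <= (2 ^+ 9 * W) ^+ (2 * k).
  apply: lerXn2r; rewrite ?nnegrE//; first by rewrite mulr_ge0// exprn_ge0.
  by rewrite ler_peMl// exprn_ege1//; lra.
apply: (@le_trans _ _ (K * (2 * (2 ^+ 9 * W) ^+ (2 * k)))).
  by apply: ler_wpM2l => //; lra.
have -> : Phi s (2 * k) = 2 * (2 ^+ 10 * W) by rewrite /Phi /W; ring.
rewrite mulrA [K * 2]mulrC /K -exprS -E2 [leRHS]exprMn.
apply: ler_wpM2l; first exact: exprn_ge0.
apply: lerXn2r; rewrite ?nnegrE; [by rewrite mulr_ge0// exprn_ge0..|].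
by rewrite ler_wpM2r// ler_weXn2l//; lra.
Qed.

(** A last pass at the exponent p. The bound is left as [Psi] and not replaced by a square: its term
    linear in the order is what yields the Gaussian range ε^2 n. *)
Lemma centered_moment_le (j : nat) (p : R) : 2 <= p ->
  (\int[Q]_x (`|psum p x - pmean p| ^+ (2 * 2 ^ j)%N)%:E <= (Psi p (2 * 2 ^ j)%N ^+ (2 ^ j)%N)%:E)%E.
Proof.
move=> p2; set k := (2 ^ j)%N; have k0 : (0 < k)%N by rewrite expn_gt0.
have [k' kE] : exists k', k = k'.+1 by exists k.-1; rewrite prednK.
have p22 : 2 <= 2 * p - 2 by lra.
rewrite [in leLHS]kE; apply: (le_trans (centered_moment _ p2)); rewrite -kE.
apply: (@le_trans _ _ (((2 ^+ 7 * p ^+ 2 * (2 * k)%:R) ^+ k)%:E * (Phi (2 * p - 2) k ^+ k)%:E)%E).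
  apply: lee_wpmul2l; first by rewrite lee_fin exprn_ge0// mulr_ge0// mulr_ge0// sqr_ge0.
  exact: psum_moment_le.
rewrite -EFinM lee_fin -exprMn; have h := Phi_le_Psi p2 k0.
apply: lerXn2r; rewrite ?nnegrE//; last first.
  by apply: le_trans h; rewrite mulr_ge0 ?Phi_ge0// mulr_ge0// mulr_ge0// sqr_ge0.
by rewrite mulr_ge0 ?Phi_ge0// mulr_ge0// mulr_ge0// sqr_ge0.
Qed.

End recursion.

(** * Deviation of A_p by Markov's inequality *)

Section tail.
Context {R : realType} {n : nat}.
Notation Bn := (borel_rV R n).
Context d (S : measurableType d) (nu : {finite_measure set S -> \bar R}).
Context (e : S -> Bn).
Context (me : measurable_fun [set: S] e).
Context (e01 : forall t, enorm (e t) = 0 \/ enorm (e t) = 1).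
Context (iso : forall x : 'rV[R]_n,
  (\int[nu]_t (dot x (e t) ^+ 2)%:E = (dot x x)%:E)%E).
Context (Q : probability Bn R).
Context (QG : gauss_law Q).
Notation psum := (psum nu e).

Notation pmean := (pmean nu e Q).

(* Comparing [Psi p r] with [(eta * pmean p) ^+ 2] through [pmean_ge], the factor [acst] comes
   from the term of [Psi] linear in [r]; [vcst] is the case r = 2. *)
Definition tcst (p : R) : R := 2 ^+ 18 * p ^+ 2 * expR (6 * p + 2).
Definition acst (p : R) : R := (2 * tcst p * 2 `^ p)^-1.
Definition vcst (p : R) : R := 2 ^+ 18 * p ^+ 2 * expR (6 * p) * (2 * 2 `^ p + 8 `^ p).

Lemma tcst_gt0 (p : R) : 2 <= p -> 0 < tcst p.
Proof.
move=> p2; rewrite /tcst mulr_gt0 ?expR_gt0// mulr_gt0// exprn_gt0//; lra.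
Qed.

(** This is why c is absolute: after the p-th root [tcst p] costs no more than e^18. *)
Lemma tcst_le (p : R) : 2 <= p -> tcst p <= expR (18 * p).
Proof.
move=> p2; have -> : 18 * p = 9 * p + 2 * p + 7 * p by ring.
rewrite expRD expRD /tcst; apply: ler_pM; rewrite ?expR_ge0//.
- by rewrite mulr_ge0 ?exprn_ge0//; lra.
- apply: ler_pM; rewrite ?exprn_ge0//; first lra.
    apply: (@le_trans _ _ (expR 1 ^+ 18)).
      by apply: lerXn2r; rewrite ?nnegrE ?expR_ge0//; have := expR_ge1Dx (1 : R); lra.
    by rewrite -expRM_natl ler_expR; lra.
  have -> : 2 * p = p + p by ring.
  rewrite expRD expr2; have := expR_ge1Dx p => h.
  by apply: ler_pM; lra.
- by rewrite ler_expR; lra.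
Qed.

Lemma pmean_gt0 (p : R) : 2 <= p -> (0 < n)%N -> 0 < pmean p.
Proof.
move=> p2 n0; apply: lt_le_trans (pmean_ge me e01 iso QG p2).
by rewrite mulr_gt0 ?ltr0n// mulr_gt0 ?expR_gt0// powR_gt0; lra.
Qed.

Lemma pmean_sqr_ge (p : R) : 2 <= p ->
  n%:R ^+ 2 * p `^ p * expR (- (6 * p)) <= pmean p ^+ 2.
Proof.
move=> p2; have -> : n%:R ^+ 2 * p `^ p * expR (- (6 * p)) =
  (n%:R * (p `^ (p / 2) * expR (- (3 * p)))) ^+ 2.
  have h1 : (p `^ (p / 2)) ^+ 2 = p `^ p.
    by rewrite -powR_mulrn ?powR_ge0// -powRrM divfK.
  have h2 : expR (- (3 * p)) ^+ 2 = expR (- (6 * p)).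
    by rewrite -expRM_natl; congr expR; ring.
  by rewrite -h1 -h2; ring.
apply: lerXn2r; rewrite ?nnegrE ?pmean_ge0//; last exact: (pmean_ge me e01 iso QG).
by rewrite mulr_ge0// mulr_ge0 ?powR_ge0 ?expR_ge0.
Qed.

Lemma measurable_dev (f : Bn -> R) (a b : R) : measurable_fun [set: Bn] f ->
  measurable ([set x | (a < `|f x - b|)%R] : set Bn).
Proof.
move=> mf; have mnf : measurable_fun [set: Bn] (fun x => `|f x - b|).
  by apply: measurableT_comp => //; exact: measurable_funB.
rewrite -[X in measurable X]setTI.
have := mnf measurableT `]a, +oo[%classic (measurable_itv _).
by congr (measurable _); apply/seteqP; split => x /= [_]; rewrite in_itv/= andbT.
Qed.

Lemma markov_exprn (f : Bn -> R) (c : R) (r : nat) : measurable_fun [set: Bn] f -> 0 <= c ->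
  ((c ^+ r)%:E * Q [set x | (c < `|f x|)%R] <= \int[Q]_x (`|f x| ^+ r)%:E)%E.
Proof.
move=> mf c0.
have mA : measurable ([set x | (c < `|f x|)%R] : set Bn).
  have := measurable_dev c 0 mf; congr measurable.
  by apply/seteqP; split => x /=; rewrite subr0.
have mr : measurable_fun [set: Bn] (fun x => (`|f x| ^+ r)%:E).
  by apply/measurable_EFinP/measurable_funX; exact: measurableT_comp.
rewrite -integral_cst//.
apply: (@le_trans _ _ (\int[Q]_(x in [set x | (c < `|f x|)%R]) (`|f x| ^+ r)%:E)%E).
  apply: ge0_le_integral => //.
  - by move=> x _; rewrite lee_fin exprn_ge0.
  - exact: measurable_funTS.
  - by move=> x /= cx; rewrite lee_fin; apply: lerXn2r; rewrite ?nnegrE// ltW.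
by apply: ge0_subset_integral => // x _; rewrite lee_fin exprn_ge0.
Qed.

Lemma psum_tail_dyadic (j : nat) (p eta : R) : 2 <= p -> (0 < n)%N -> 0 < eta ->
  (2 * 2 ^ j)%:R <= acst p * eta ^+ 2 * n%:R ->
  (2 * 2 ^ j)%:R <= expR (- 18) / 4 * (eta * n%:R) `^ (2 / p) ->
  (Q [set x | (eta * pmean p < `|psum p x - pmean p|)%R] <= (expR (- (2 * 2 ^ j)%:R))%:E)%E.
Proof.
move=> p2 n0 eta0; set k := (2 ^ j)%N; set r : R := (2 * k)%:R => h1 h2.
have nR : (0 : R) < n%:R by rewrite ltr0n.
have m0 := pmean_gt0 p2 n0.
have r0 : 0 <= r by exact: ler0n.
have t0 := tcst_gt0 p2.
have p0 : 0 < p by lra.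
(* The factor e^(-2), raised to the power k, becomes the e^(-2k) of the conclusion. The exponent 6p
   + 2 in [tcst] pays for it and for the e^(-6p) lost in [pmean_sqr_ge]. *)
have PsiE : Psi (n := n) p (2 * k) <= expR (- 2) * (eta * pmean p) ^+ 2.
  (* Each hypothesis on the order controls one of the two terms of [Psi], and each term takes half
     of (eta n)^2. *)
  have a1 : tcst p * (2 `^ p * r * n%:R) <= (eta * n%:R) ^+ 2 / 2.
    have tp0 : 0 < 2 * tcst p * 2 `^ p by rewrite mulr_gt0 ?powR_gt0// mulr_gt0.
    have : r * (2 * tcst p * 2 `^ p) <= eta ^+ 2 * n%:R.
      by rewrite -ler_pdivlMr// mulrC mulrA.
    move=> /(ler_wpM2r (ltW nR)) h; rewrite exprMn [n%:R ^+ 2]expr2; lra.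
  have a2 : tcst p * (4 * r) `^ p <= (eta * n%:R) ^+ 2.
    have h4 : 4 * r <= expR (- 18) * (eta * n%:R) `^ (2 / p) by lra.
    have : (4 * r) `^ p <= (expR (- 18) * (eta * n%:R) `^ (2 / p)) `^ p.
      by apply: ge0_ler_powR; rewrite ?nnegrE ?mulr_ge0 ?expR_ge0 ?powR_ge0 ?(ltW p0).
    rewrite [leRHS]powRM ?expR_ge0 ?powR_ge0//.
    have -> : ((eta * n%:R) `^ (2 / p)) `^ p = (eta * n%:R) ^+ 2.
      by rewrite -powRrM divfK ?(gt_eqF p0)// powR_mulrn// mulr_ge0 ?(ltW eta0) ?(ltW nR).
    rewrite -expRM => h5.
    apply: (@le_trans _ _ (expR (18 * p) * (expR (- 18 * p) * (eta * n%:R) ^+ 2))).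
      by apply: ler_pM => //; rewrite ?(ltW t0) ?powR_ge0 ?tcst_le.
    by rewrite mulrA -expRD mulNr subrr expR0 mul1r.
  have a3 : 2 ^+ 18 * p ^+ 2 * expR (6 * p + 2) * (2 `^ p * r * n%:R + (4 * r) `^ p / 2) <=
     eta ^+ 2 * n%:R ^+ 2.
    by rewrite -exprMn -/(tcst p); lra.
  apply: (@le_trans _ _ (expR (- 2) * (eta ^+ 2 * (n%:R ^+ 2 * p `^ p * expR (- (6 * p)))))); last first.
    by rewrite exprMn; apply: ler_wpM2l; rewrite ?expR_ge0//; apply: ler_wpM2l; rewrite ?sqr_ge0 ?pmean_sqr_ge.
  have -> : expR (- 2) * (eta ^+ 2 * (n%:R ^+ 2 * p `^ p * expR (- (6 * p)))) =
     (expR (- (6 * p + 2)) * p `^ p) * (eta ^+ 2 * n%:R ^+ 2).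
    by rewrite [in RHS]opprD expRD; ring.
  apply: (@le_trans _ _ ((expR (- (6 * p + 2)) * p `^ p) * (2 ^+ 18 * p ^+ 2 * expR (6 * p + 2) * (2 `^ p * r * n%:R + (4 * r) `^ p / 2)))); last first.
    by apply: ler_wpM2l => //; rewrite mulr_ge0 ?expR_ge0 ?powR_ge0.
  rewrite /Psi -/r powRD ?(gt_eqF p0) ?implybT// (powR_mulrn 2 (ltW p0)) expRN.
  set E := expR (6 * p + 2); set w := _ + _ / 2.
  have E0 : E != 0 by rewrite gt_eqF ?expR_gt0.
  have -> : E^-1 * p `^ p * (2 ^+ 18 * p ^+ 2 * E * w) =
    2 ^+ 18 * (p `^ p * p ^+ 2) * w * (E^-1 * E) by ring.
  by rewrite mulVf// mulr1.
have mf : measurable_fun [set: Bn] (fun x => psum p x - pmean p).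
  by apply: measurable_funB => //; exact: measurable_psum.
have c0 : 0 < eta * pmean p by rewrite mulr_gt0.
have := le_trans (markov_exprn (2 * k) mf (ltW c0)) (centered_moment_le me e01 iso QG j p2).
rewrite -/k => h.
have h3 : (((eta * pmean p) ^+ (2 * k))%:E * Q [set x | (eta * pmean p < `|psum p x - pmean p|)%R] <=
  ((eta * pmean p) ^+ (2 * k))%:E * (expR (- r))%:E)%E.
  apply: (le_trans h); rewrite -EFinM lee_fin exprM.
  have -> : expR (- r) = expR (- 2) ^+ k by rewrite -expRM_natl /r natrM mulrN mulrC.
  rewrite -exprMn mulrC; apply: lerXn2r => //; rewrite nnegrE; last first.
    by rewrite mulr_ge0 ?expR_ge0 ?sqr_ge0.
  by rewrite /Psi mulr_ge0// mulr_ge0 ?powR_ge0.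
have cr0 : 0 < (eta * pmean p) ^+ (2 * k) by exact: exprn_gt0.
by rewrite lee_pmul2l// in h3.
Qed.

Lemma prob_le1E (A : set Bn) (y : R) : measurable A -> 1 <= y -> (Q A <= y%:E)%E.
Proof. by move=> mA y1; apply: (le_trans (probability_le1 Q mA)); rewrite lee_fin. Qed.

Lemma psum_tail (p eta : R) : 2 <= p -> (0 < n)%N -> 0 < eta ->
  (Q [set x | (eta * pmean p < `|psum p x - pmean p|)%R] <=
   (expR 1 * expR (- (Num.min (acst p * eta ^+ 2 * n%:R)
      (expR (- 18) / 4 * (eta * n%:R) `^ (2 / p)) / 2)))%:E)%E.
Proof.
move=> p2 n0 eta0; set L := Num.min _ _.
have mA := measurable_dev (eta * pmean p) (pmean p) (measurable_psum nu me p).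
(* For L < 2 there is no admissible order 2 * 2^j, but then the prefactor e makes the bound at least
   1. *)
have [L2|L2] := ltP L 2.
  apply: prob_le1E => //; rewrite -expRD -[leLHS]expR0 ler_expR; lra.
have L0 : 0 <= L by lra.
have m2 : (1 < Num.truncn L)%N by rewrite truncn_gt_nat; lra.
have m0 : (0 < Num.truncn L)%N by exact: ltnW.
(* The largest power of two below L is chosen as the order. It exceeds L up to a factor 2, whence
   the division by 2 in the exponent, and it is at least 2, so it has the form 2 * 2^j. *)
have /andP[b1 b2] := trunc_log_bounds (isT : 1 < 2)%N m0.
have : (0 < trunc_log 2 (Num.truncn L))%N by rewrite trunc_log_gt0 m2.
case: (trunc_log 2 (Num.truncn L)) b1 b2 => // j b1 b2 _.
have r1 : (2 * 2 ^ j)%:R <= L.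
  apply: (@le_trans _ _ (Num.truncn L)%:R); first by rewrite ler_nat -expnS.
  by rewrite truncn_le.
have r2 : L <= 2 * (2 * 2 ^ j)%:R.
  apply: (@le_trans _ _ (Num.truncn L).+1%:R); first by rewrite ltW// truncnS_gt.
  by rewrite -natrM ler_nat -!expnS.
have /andP[r3 r4] : ((2 * 2 ^ j)%:R <= acst p * eta ^+ 2 * n%:R) &&
  ((2 * 2 ^ j)%:R <= expR (- 18) / 4 * (eta * n%:R) `^ (2 / p)).
  by rewrite -le_min.
apply: (le_trans (psum_tail_dyadic p2 n0 eta0 r3 r4)).
rewrite lee_fin -expRD ler_expR; lra.
Qed.

End tail.

(** * From A_p to the norm *)

Section transfer.
Context {R : realType} {n : nat}.
Notation Bn := (borel_rV R n).
Context d (S : measurableType d) (nu : {finite_measure set S -> \bar R}).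
Context (e : S -> Bn).
Context (me : measurable_fun [set: S] e).
Context (e01 : forall t, enorm (e t) = 0 \/ enorm (e t) = 1).
Context (iso : forall x : 'rV[R]_n,
  (\int[nu]_t (dot x (e t) ^+ 2)%:E = (dot x x)%:E)%E).
Context (Q : probability Bn R).
Context (QG : gauss_law Q).
Notation psum := (psum nu e).

Notation pmean := (pmean nu e Q).

(** Monotonicity of y^(p-1) gives |a - b| b^(p-1) <= |a^p - b^p|; the extra factor b removes the
    exponent p - 1. Thus relative deviations do not grow when p-th roots are taken. *)
Lemma root_dist (p a b : R) : 1 < p -> 0 <= a -> 0 <= b ->
  `|a - b| * b `^ p <= b * `|a `^ p - b `^ p|.
Proof.
move=> p1 a0 b0.
have split (x : R) : 0 <= x -> x `^ p = x * x `^ (p - 1).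
  move=> x0; rewrite -{2}(powRr1 x0) -powRD ?subrKC//.
  by apply/implyP => /eqP h; exfalso; lra.
have mon (x y : R) : 0 <= x -> x <= y -> x `^ (p - 1) <= y `^ (p - 1).
  by move=> x0 xy; apply: ge0_ler_powR; rewrite ?nnegrE ?(le_trans x0 xy)//; lra.
rewrite [in leLHS](split b)// mulrCA; apply: ler_wpM2l => //.
have [ab|ba] := leP a b.
  rewrite ler0_norm ?subr_le0// ler0_norm ?subr_le0; last first.
    by apply: ge0_ler_powR; rewrite ?nnegrE//; lra.
  rewrite (split a)// (split b)//.
  have := ler_wpM2l a0 (mon _ _ a0 ab); lra.
rewrite gtr0_norm ?subr_gt0// ger0_norm ?subr_ge0; last first.
  by apply: ge0_ler_powR; rewrite ?nnegrE ?(ltW ba)//; lra.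
rewrite (split a)// (split b)//.
have := ler_wpM2l a0 (mon _ _ b0 (ltW ba)); lra.
Qed.

Definition proot (p : R) (x : 'rV[R]_n) : R := psum p x `^ p^-1.
(** An explicit center for the norm, used until the true mean [pcenter] is shown to be close to
    it. *)
Definition pmid (p : R) : R := pmean p `^ p^-1.

Lemma proot_ge0 (p : R) x : 0 <= proot p x.
Proof. exact: powR_ge0. Qed.

Lemma measurable_proot (p : R) : measurable_fun [set: Bn] (proot p).
Proof.
apply: (measurableT_comp (measurable_powR p^-1)); exact: measurable_psum.
Qed.

Lemma proot_le (p : R) x : 2 <= p -> proot p x <= 1 + psum p x.
Proof.
move=> p2; have h := psum_ge0 nu e p x; rewrite /proot.
have [a1|a1] := leP (psum p x) 1.
  have : psum p x `^ p^-1 <= 1 `^ p^-1.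
    by apply: ge0_ler_powR; rewrite ?nnegrE ?invr_ge0//; lra.
  by rewrite powR1; lra.
have : psum p x `^ p^-1 <= psum p x `^ 1.
  by apply: ler_powR; rewrite ?(ltW a1)// invf_le1; lra.
by rewrite powRr1//; lra.
Qed.

Lemma proot_integrable (p : R) : 2 <= p -> Q.-integrable [set: Bn] (EFin \o proot p).
Proof.
move=> p2.
have h : Q.-integrable [set: Bn] (fun x => 1%:E + (psum p x)%:E)%E.
  have h1 : Q.-integrable [set: Bn] (EFin \o cst (1 : R)) by exact: finite_measure_integrable_cst.
  have h2 := psum_Q_integrable me e01 iso QG p2.
  exact: (integrableD measurableT h1 h2).
apply: le_integrable h => //.
  by apply/measurable_EFinP; exact: measurable_proot.
move=> x _ /=; rewrite lee_fin ger0_norm ?proot_ge0// ger0_norm ?proot_le//.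
by rewrite addr_ge0 ?psum_ge0.
Qed.

Lemma proot_pmid (p : R) x : 2 <= p -> (0 < n)%N ->
  `|proot p x - pmid p| * pmean p <= pmid p * `|psum p x - pmean p|.
Proof.
move=> p2 n0.
have K (y : R) : 0 <= y -> (y `^ p^-1) `^ p = y.
  by move=> y0; rewrite -powRrM mulVf ?powRr1// gt_eqF//; lra.
have := @root_dist p (proot p x) (pmid p) _ (powR_ge0 _ _) (powR_ge0 _ _).
by rewrite !K ?psum_ge0 ?pmean_ge0//; apply; lra.
Qed.

Lemma vcst_gt0 (p : R) : 2 <= p -> 0 < vcst p.
Proof.
move=> p2; rewrite /vcst mulr_gt0 ?addr_gt0 ?mulr_gt0 ?expR_gt0 ?powR_gt0 ?exprn_gt0//; lra.
Qed.

(** At order 2 both terms of [Psi] are at most linear in n, the second because n >= 1, while the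
    squared mean is of order n^2. *)
Lemma Psi_le_vcst (p : R) : 2 <= p -> (0 < n)%N ->
  Psi (n := n) p 2 <= vcst p / n%:R * pmean p ^+ 2.
Proof.
move=> p2 n0; have nR : (0 : R) < n%:R by rewrite ltr0n.
have n1 : (1 : R) <= n%:R by rewrite ler1n.
have p0 : 0 < p by lra.
apply: (@le_trans _ _ (vcst p / n%:R * (n%:R ^+ 2 * p `^ p * expR (- (6 * p))))); last first.
  by apply: ler_wpM2l; rewrite ?pmean_sqr_ge// divr_ge0 ?(ltW (vcst_gt0 p2)) ?(ltW nR).
rewrite expRN /vcst /Psi powRD ?(gt_eqF p0) ?implybT// (powR_mulrn 2 (ltW p0)).
have -> : 4 * 2%:R = 8 :> R by rewrite -natrM.
set E := expR (6 * p).
have E0 : E != 0 by rewrite gt_eqF ?expR_gt0.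
have n0' : n%:R != 0 :> R by rewrite gt_eqF.
have -> : 2 ^+ 18 * p ^+ 2 * E * (2 * 2 `^ p + 8 `^ p) / n%:R * (n%:R ^+ 2 * p `^ p / E) =
  2 ^+ 18 * (p `^ p * p ^+ 2) * (2 * 2 `^ p * n%:R + 8 `^ p * n%:R) * (E^-1 * E) * (n%:R^-1 * n%:R) by ring.
rewrite mulVf// mulVf// !mulr1; apply: ler_wpM2l.
  by rewrite mulr_ge0 ?exprn_ge0// mulr_ge0 ?powR_ge0 ?sqr_ge0.
have := ler_wpM2l (powR_ge0 8 p) n1; have := powR_ge0 (8 : R) p; lra.
Qed.

Lemma proot_variance (p : R) : 2 <= p -> (0 < n)%N ->
  (\int[Q]_x (`|proot p x - pmid p| ^+ 2)%:E <= (pmid p ^+ 2 * (vcst p / n%:R))%:E)%E.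
Proof.
move=> p2 n0; have m0 := pmean_gt0 me e01 iso QG p2 n0.
have m20 : 0 < pmean p ^+ 2 by rewrite exprn_gt0.
have mf : measurable_fun [set: Bn] (fun x => (`|proot p x - pmid p| ^+ 2)%:E).
  apply/measurable_EFinP/measurable_funX; apply: measurableT_comp => //.
  by apply: measurable_funB => //; exact: measurable_proot.
have mg : measurable_fun [set: Bn] (fun x => (`|psum p x - pmean p| ^+ 2)%:E).
  apply/measurable_EFinP/measurable_funX; apply: measurableT_comp => //.
  by apply: measurable_funB => //; exact: measurable_psum.
rewrite -(lee_pmul2l _ (_ : 0 < (pmean p ^+ 2)%:E)%E)//.
rewrite -ge0_integralZl ?lee_fin ?(ltW m20)//.
apply: (@le_trans _ _ (\int[Q]_x ((pmid p ^+ 2)%:E * (`|psum p x - pmean p| ^+ 2)%:E))%E).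
  apply: ge0_le_integral => //.
  - by move=> x _; rewrite -EFinM lee_fin mulr_ge0 ?exprn_ge0// ltW.
  - exact: measurable_funeM.
  - exact: measurable_funeM.
  move=> x _; rewrite -!EFinM lee_fin -!exprMn mulrC.
  apply: lerXn2r; rewrite ?nnegrE ?mulr_ge0 ?powR_ge0 ?(ltW m0)//.
  exact: proot_pmid.
rewrite ge0_integralZl ?lee_fin ?sqr_ge0//.
apply: (@le_trans _ _ ((pmid p ^+ 2)%:E * (Psi (n := n) p 2)%:E)%E).
  apply: lee_wpmul2l; rewrite ?lee_fin ?sqr_ge0//.
  by have := centered_moment_le me e01 iso QG 0 p2; rewrite expr1.
rewrite -(EFinM (pmid p ^+ 2)) -(EFinM (pmean p ^+ 2)) lee_fin [leRHS]mulrCA.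
apply: ler_wpM2l; rewrite ?sqr_ge0//.
by rewrite mulrC Psi_le_vcst.
Qed.

Definition pcenter (p : R) : R := \int[Q]_x proot p x.

Lemma pcenter_dist (p : R) : 2 <= p -> (0 < n)%N ->
  (pcenter p - pmid p) ^+ 2 <= pmid p ^+ 2 * (vcst p / n%:R).
Proof.
move=> p2 n0; rewrite -lee_fin.
apply: le_trans (proot_variance p2 n0).
have ic : Q.-integrable [set: Bn] (EFin \o cst (pmid p)) by exact: finite_measure_integrable_cst.
have i1 : Q.-integrable [set: Bn] (EFin \o (fun x => proot p x - pmid p)).
  have -> : EFin \o (fun x => proot p x - pmid p) = ((EFin \o proot p) \- (EFin \o cst (pmid p)))%E :> (Bn -> \bar R).
    by apply/funext => x /=; rewrite EFinB.
  by apply: integrableB => //; exact: proot_integrable.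
have := jensen_exprn 1 i1.
rewrite RintegralB//; last exact: proot_integrable.
rewrite Rintegral_cst// [fine (Q setT)](_ : _ = 1) ?mulr1; last by rewrite probability_setT.
by rewrite real_normK ?num_real.
Qed.

(** The second entry of the minimum makes the tail bound trivial when ε^2 n < 16 [vcst p], the range
    in which the mean is not known to be close enough to [pmid]. *)
Definition apar (p : R) : R := Num.min (acst p) (16 * vcst p)^-1.

Lemma apar_gt0 (p : R) : 2 <= p -> 0 < apar p.
Proof.
move=> p2; rewrite /apar lt_min /acst !invr_gt0; apply/andP; split.
  have t0 := tcst_gt0 p2; rewrite mulr_gt0 ?(mulr_gt0 _ t0) ?powR_gt0//.
by rewrite mulr_gt0 ?vcst_gt0.
Qed.

Lemma proot_tail (p eps : R) : 2 <= p -> (0 < n)%N -> 0 < eps < 1 ->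
  (Q [set x | (eps * pcenter p < `|proot p x - pcenter p|)%R] <=
   (expR 1 * expR (- (expR (- 18) / 32 *
     Num.min (apar p * eps ^+ 2 * n%:R) ((eps * n%:R) `^ (2 / p)))))%:E)%E.
Proof.
move=> p2 n0 /andP[e0 e1].
have nR : (0 : R) < n%:R by rewrite ltr0n.
have v0 := vcst_gt0 p2.
have m0 := pmean_gt0 me e01 iso QG p2 n0.
have W0 : 0 < pmid p by rewrite powR_gt0.
have c1 : expR (- 18) <= 1 :> R by rewrite -[leRHS]expR0 ler_expR; lra.
have c0 : 0 < expR (- 18) :> R by rewrite expR_gt0.
have mA := measurable_dev (eps * pcenter p) (pcenter p) (measurable_proot p).
have aE : 0 <= eps ^+ 2 * n%:R by rewrite mulr_ge0 ?sqr_ge0 ?(ltW nR).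
set L := Num.min _ _.
have [big|small] := leP (16 * vcst p) (eps ^+ 2 * n%:R); last first.
  apply: prob_le1E => //; rewrite -expRD -[leLHS]expR0 ler_expR.
  have : L <= 1.
    rewrite ge_min; apply/orP; left; rewrite -mulrA.
    apply: (@le_trans _ _ ((16 * vcst p)^-1 * (16 * vcst p))).
      apply: ler_pM => //; rewrite ?(ltW (apar_gt0 p2)) ?(ltW small)//.
      by rewrite ge_min lexx orbT.
    by rewrite mulVf// gt_eqF// mulr_gt0.
  move=> /(ler_wpM2l (_ : 0 <= expR (- 18) / 32)); lra.
(* Here ε^2 n >= 16 [vcst p], so the distance sqrt(vcst / n) relative to [pmid] is at most ε/4. *)
have near : `|pcenter p - pmid p| <= eps * pmid p / 4.
  rewrite -ler_sqr ?nnegrE ?divr_ge0 ?mulr_ge0 ?(ltW e0) ?(ltW W0)//.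
  rewrite real_normK ?num_real//; apply: (le_trans (pcenter_dist p2 n0)).
  have -> : (eps * pmid p / 4) ^+ 2 = pmid p ^+ 2 * (eps ^+ 2 / 16) by field.
  apply: ler_wpM2l; rewrite ?sqr_ge0// ler_pdivrMr//; lra.
(* As ε < 1, the mean is at least 3/4 of [pmid]. A deviation ε [pcenter] from the mean is thus more
   than 3ε/4 - ε/4 from [pmid], relative to [pmid], which leaves ε/4 with room to spare. *)
have sub : [set x | (eps * pcenter p < `|proot p x - pcenter p|)%R] `<=`
   [set x | (eps / 4 * pmean p < `|psum p x - pmean p|)%R].
  move=> x /= hx.
  have h1 : eps / 4 * pmid p < `|proot p x - pmid p|.
    have h2 := ler_distD (pmid p) (proot p x) (pcenter p).
    rewrite [`|pmid p - _|]distrC in h2.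
    have h3 : pmid p - pcenter p <= `|pcenter p - pmid p| by rewrite distrC ler_norm.
    have h4 : eps * pmid p <= pmid p by rewrite ger_pMl// ltW.
    have h7 : 0 < eps * pmid p by rewrite mulr_gt0.
    have h5 : eps * (3 / 4 * pmid p) <= eps * pcenter p by rewrite ler_pM2l//; lra.
    lra.
  have h6 := proot_pmid x p2 n0.
  rewrite -(ltr_pM2l W0); apply: lt_le_trans h6.
  by rewrite mulrCA mulrA ltr_pM2r.
have mB := measurable_dev (eps / 4 * pmean p) (pmean p) (measurable_psum nu me p).
have h : (Q [set x | (eps * pcenter p < `|proot p x - pcenter p|)%R] <=
   Q [set x | (eps / 4 * pmean p < `|psum p x - pmean p|)%R])%E.
  by apply: le_measure; rewrite ?inE.
apply: (le_trans h).
apply: (le_trans (psum_tail me e01 iso QG p2 n0 (_ : 0 < eps / 4))); first lra.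
rewrite lee_fin ler_pM2l ?expR_gt0// ler_expR lerN2.
(* The 32 is accounted for here: a factor 2 comes from the dyadic order, and passing from ε to ε/4
   costs 16 in the first entry and at most 4 in the second, as 2/p <= 1; the second entry already
   carries another 4. *)
rewrite ler_pdivlMr// le_min; apply/andP; split.
  apply: (@le_trans _ _ (expR (- 18) / 32 * (apar p * eps ^+ 2 * n%:R) * 2)).
    by rewrite ler_pM2r// ler_pM2l ?ge_min ?lexx// divr_gt0.
  have h1 : apar p * (eps ^+ 2 * n%:R) <= acst p * (eps ^+ 2 * n%:R).
    by apply: ler_wpM2r => //; rewrite ge_min lexx.
  have h2 : 0 <= apar p * (eps ^+ 2 * n%:R) by rewrite mulr_ge0 ?(ltW (apar_gt0 p2)).
  have h3 : expR (- 18) * (apar p * (eps ^+ 2 * n%:R)) <= apar p * (eps ^+ 2 * n%:R).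
    exact: ler_piMl.
  lra.
apply: (@le_trans _ _ (expR (- 18) / 32 * (eps * n%:R) `^ (2 / p) * 2)).
  by rewrite ler_pM2r// ler_pM2l ?ge_min ?lexx ?orbT// divr_gt0.
have -> : eps / 4 * n%:R = 4^-1 * (eps * n%:R) by rewrite mulrAC mulrC.
rewrite (powRM _ (_ : 0 <= 4^-1)) ?mulr_ge0 ?(ltW e0) ?(ltW nR)//.
set w := (eps * n%:R) `^ _.
have w0 : 0 <= w by exact: powR_ge0.
have h4 : 4^-1 <= 4^-1 `^ (2 / p) :> R.
  rewrite -[leLHS]powRr1//; apply: ger_powR; rewrite ?ler_pdivrMr//; lra.
have h5 : 4^-1 * w <= 4^-1 `^ (2 / p) * w by exact: ler_wpM2r.
have h6 : 0 <= 4^-1 `^ (2 / p) * w - 4^-1 * w by lra.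
have := mulr_ge0 (ltW c0) h6; have := mulr_ge0 (ltW c0) w0; lra.
Qed.

(* [4 * vcst p] times the factor of [n `^ (2 / p)] in the bound of [pmid p ^+ 2]. *)
Definition wcst (p : R) : R := 4 * vcst p * (2 * p `^ (p / 2)) `^ (2 / p).

Lemma wcst_gt0 (p : R) : 2 <= p -> 0 < wcst p.
Proof.
move=> p2; have v0 := vcst_gt0 p2.
have q0 : 0 < 2 * p `^ (p / 2) by rewrite mulr_gt0 ?powR_gt0//; lra.
by rewrite /wcst mulr_gt0 ?(mulr_gt0 _ v0) ?powR_gt0.
Qed.

Lemma proot_variance_pcenter (p : R) : 2 <= p -> (0 < n)%N ->
  (\int[Q]_x ((proot p x - pcenter p) ^+ 2)%:E <= (wcst p * n%:R `^ (2 / p - 1))%:E)%E.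
Proof.
move=> p2 n0; have nR : (0 : R) < n%:R by rewrite ltr0n.
have m0 := pmean_gt0 me e01 iso QG p2 n0.
have p0 : 0 < p by lra.
have hW : pmid p ^+ 2 <= n%:R `^ (2 / p) * (2 * p `^ (p / 2)) `^ (2 / p).
  rewrite -powRM ?mulr_ge0 ?powR_ge0// /pmid -powR_mulrn ?powR_ge0// -powRrM mulrC.
  apply: ge0_ler_powR; rewrite ?nnegrE ?divr_ge0 ?(ltW p0) ?(ltW m0) ?mulr_ge0 ?powR_ge0//.
  exact: (pmean_le me e01 iso QG).
set V := pmid p ^+ 2 * (vcst p / n%:R).
have mf : measurable_fun [set: Bn] (fun x => (`|proot p x - pmid p| ^+ 2)%:E).
  apply/measurable_EFinP/measurable_funX; apply: measurableT_comp => //.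
  by apply: measurable_funB => //; exact: measurable_proot.
(* (a - c)^2 <= 2 (a - b)^2 + 2 (c - b)^2 with [pmid p] for b: each part contributes 2V, hence the 4
   in [wcst]. *)
apply: (@le_trans _ _ (\int[Q]_x (2%:E * (`|proot p x - pmid p| ^+ 2)%:E + (2 * V)%:E))%E).
  apply: ge0_le_integral => //.
  - by move=> x _; rewrite lee_fin sqr_ge0.
  - apply/measurable_EFinP/measurable_funX.
    by apply: measurable_funB => //; exact: measurable_proot.
  - by apply: emeasurable_funD => //; exact: measurable_funeM.
  move=> x _; rewrite -EFinM -EFinD lee_fin real_normK ?num_real//.
  have := pcenter_dist p2 n0; rewrite -/V.
  have := sqr_ge0 ((proot p x - pmid p) + (pcenter p - pmid p)); nra.
have V0 : 0 <= V by rewrite mulr_ge0 ?sqr_ge0// divr_ge0 ?(ltW (vcst_gt0 p2)) ?(ltW nR).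
rewrite ge0_integralD//; [|exact: measurable_funeM|by move=> x _; rewrite lee_fin mulr_ge0].
rewrite ge0_integralZl//.
have -> : (\int[Q]_x (2 * V)%:E = (2 * V)%:E)%E.
  by rewrite integral_cst// [X in (_ * X)%E](probability_setT Q) mule1.
apply: (@le_trans _ _ (2%:E * V%:E + (2 * V)%:E)%E).
  by rewrite leeD2r// lee_pmul2l// proot_variance.
rewrite -EFinM -EFinD lee_fin /wcst powRD; last by rewrite (gt_eqF nR) implybT.
rewrite powRN powRr1 ?(ltW nR)// /V.
have := ler_wpM2r (_ : 0 <= 4 * (vcst p / n%:R)) hW.
have -> : 0 <= 4 * (vcst p / n%:R) by rewrite mulr_ge0 ?divr_ge0 ?(ltW (vcst_gt0 p2)) ?(ltW nR).
move=> /(_ isT); lra.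
Qed.

End transfer.

(** * An isotropic measure as a finite measure with a map into the sphere *)

Section sphere.
Context {R : realType} {n : nat}.
Notation Bn := (borel_rV R n).

(** Points off the sphere go to 0, where the integrands in use vanish, so integrals over the sphere
    become integrals over the whole space. *)
Definition sphere_incl (x : Bn) : Bn := if enorm x == 1 then x else 0.

Lemma sphere_incl01 (x : Bn) : enorm (sphere_incl x) = 0 \/ enorm (sphere_incl x) = 1.
Proof.
rewrite /sphere_incl; case: ifPn => [/eqP|_]; [by right|left].
by rewrite /enorm /dot big1 ?sqrtr0// => i _; rewrite mxE mul0r.
Qed.

Lemma measurable_enorm : measurable_fun [set: Bn] (@enorm R n).
Proof.
have -> : @enorm R n = fun x => dot x x `^ 2^-1.
  by apply/funext => x; rewrite powR12_sqrt ?dot_ge0.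
apply: (measurableT_comp (measurable_powR 2^-1)).
rewrite /dot; apply: measurable_sum => i.
by apply: measurable_funM; exact: measurable_coord.
Qed.

Lemma measurable_sphere : measurable (@sphere R n : set Bn).
Proof.
have := measurable_enorm measurableT (measurable_set1 (1 : R)).
by rewrite setTI.
Qed.

Lemma measurable_sphere_incl : measurable_fun [set: Bn] sphere_incl.
Proof.
have mb : measurable_fun [set: Bn] (fun x : Bn => enorm x == 1 :> R).
  by apply: measurable_fun_eqr => //; exact: measurable_enorm.
apply: measurable_fun_ifT => //.
Qed.

Context (mu : {measure set Bn -> \bar R}).

Lemma integral_sphere_incl (f : Bn -> \bar R) : f 0 = 0%E ->
  (\int[mu]_(x in @sphere R n) f x = \int[mu]_x f (sphere_incl x))%E.
Proof.
move=> f0; rewrite integral_mkcond; apply: eq_integral => x _.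
rewrite patchE /sphere_incl; case: ifPn; rewrite ?inE /sphere/=.
  by move=> ->; rewrite eqxx.
by rewrite notin_setE/= => /eqP/negbTE ->; rewrite f0.
Qed.

Context (iso : isotropic mu).

Lemma isotropic_integral (x : 'rV[R]_n) :
  (\int[mu]_t (dot x (sphere_incl t) ^+ 2)%:E = (dot x x)%:E)%E.
Proof.
have [_ _ h] := iso; rewrite -enorm_sqr h.
rewrite (integral_sphere_incl (f := fun t => (`|dot x t| ^+ 2)%:E)).
  by apply: eq_integral => t _; rewrite real_normK ?num_real.
by rewrite /dot big1 ?normr0 ?expr0n// => i _; rewrite mxE mulr0.
Qed.

(** Isotropy forces finiteness: on the sphere 1 = |t|^2, and the integral of |t|^2 is a trace, while
    the complement has measure 0. *)
Lemma isotropic_fin_num : fin_num_fun mu.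
Proof.
have [h0 _ _] := iso.
apply: lty_fin_num_fun.
have -> : [set: Bn] = @sphere R n `|` ~` @sphere R n by rewrite setUv.
apply: (@le_lt_trans _ _ (mu (@sphere R n) + mu (~` @sphere R n))%E).
  by apply: measureU2; [|apply: measurableC]; exact: measurable_sphere.
rewrite h0 adde0.
have -> : mu (@sphere R n) = (\int[mu]_(t in @sphere R n) (dot t t)%:E)%E.
  rewrite -[LHS]mul1e -integral_cst; last exact: measurable_sphere.
  apply: eq_integral => t; rewrite inE /sphere/= => t1.
  by rewrite -enorm_sqr t1 expr1n.
rewrite (integral_sphere_incl (f := fun t => (dot t t)%:E)); last first.
  by rewrite /dot big1// => i _; rewrite mxE mulr0.
have -> : (fun t => (dot (sphere_incl t) (sphere_incl t))%:E) =
   (fun t => \sum_(i < n) (dot (delta_mx ord0 i) (sphere_incl t) ^+ 2)%:E)%E.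
  apply/funext => t; rewrite sumEFin; congr EFin.
  by apply: eq_bigr => i _; rewrite dot_delta expr2.
rewrite ge0_integral_sum//; last 2 first.
- move=> i; apply/measurable_EFinP/measurable_funX.
  apply: measurableT_comp => //; last exact: measurable_sphere_incl.
  exact: measurable_dot.
- by move=> i t _; rewrite lee_fin sqr_ge0.
under eq_bigr do rewrite isotropic_integral dot_delta mxE !eqxx.
by rewrite sumEFin ltry.
Qed.

(** A copy of [mu] to which the structure of finite measure can be attached under the hypothesis
    [iso]. *)
Definition fin_isotropic : set Bn -> \bar R := mu.

HB.instance Definition _ := Measure.copy fin_isotropic mu.

HB.instance Definition _ := Measure_isFinite.Build _ Bn R fin_isotropic isotropic_fin_num.

Lemma finite_isotropic : exists nu : {finite_measure set Bn -> \bar R},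
  nu = mu :> {measure set Bn -> \bar R}.
Proof.
exists fin_isotropic.
by apply/eq_measure.
Qed.

End sphere.

(** * The notions of the theorem in terms of [proot] and [gauss_law] *)

Section sphere_finite.
Context {R : realType} {n : nat}.
Notation Bn := (borel_rV R n).

Lemma Bp_norm_proot (nu : {finite_measure set Bn -> \bar R}) (p : R) (x : 'rV[R]_n) :
  0 < p -> Bp_norm p nu x = (proot nu sphere_incl p x)%:E.
Proof.
move=> p0; rewrite /Bp_norm.
rewrite (integral_sphere_incl nu (f := fun t => (`|dot x t| `^ p)%:E)); last first.
  by rewrite /dot big1 ?normr0 ?powR0 ?gt_eqF// => i _; rewrite mxE mulr0.
rewrite -(EFin_psum nu measurable_sphere_incl sphere_incl01 x (ltW p0)).
by rewrite poweR_EFin.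
Qed.

Lemma gauss_law_distribution d (T : measurableType d) (P : probability T R)
  (Z : {RV P >-> Bn}) : std_gaussian Z -> gauss_law (distribution P Z : probability Bn R).
Proof.
move=> [Z1 Z2] A mA.
transitivity (\prod_(i < n) P ((fun w => (Z w : 'rV[R]_n) ord0 i) @^-1` A i))%E.
  exact: Z2.
apply: eq_bigr => i _; refine (Z1 i (A i) _); exact: (mA i).
Qed.

End sphere_finite.

Unset Implicit Arguments.

Theorem theorem1p2 (R : realType) :
  exists C c : R, 0 < C /\ 0 < c /\
  forall p : R, 2 < p ->
  exists alpha_p C_p : R, 0 < alpha_p /\ 0 < C_p /\
  forall (n : nat) (nrm : 'rV[R]_n -> R),
    (0 < n)%N -> Lp_subspace p nrm -> lewis_position p nrm ->
  forall (d : measure_display) (T : measurableType d) (P : probability T R)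
         (Z : {RV P >-> borel_rV R n}),
    std_gaussian Z ->
  let X : T -> R := fun w => nrm (Z w) in
  let m : R := fine ('E_P[X])%E in
  (forall eps : R, 0 < eps < 1 ->
     (P [set w | (eps * m < `|X w - m|)%R] <=
      (C * expR (- (c * Num.min (alpha_p * eps ^+ 2 * n%:R)
                                ((eps * n%:R) `^ (2 / p)))))%:E)%E) /\
  ('V_P[X] <= (C_p * n%:R `^ (2 / p - 1))%:E)%E.
Proof.
exists (expR 1), (expR (- 18) / 32); split; first exact: expR_gt0.
split; first by rewrite divr_gt0 ?expR_gt0.
move=> p p2'; have p2 := ltW p2'; have p0 : 0 < p by lra.
exists (apar p), (wcst p); split; first exact: apar_gt0.
split; first exact: wcst_gt0.
move=> n nrm n0 _ [mu [isomu nrmE]] d T P Z gZ X m.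
have [nu nuE] := finite_isotropic isomu.
subst mu.
have iso := isotropic_integral isomu.
have {}nrmE x : nrm x = proot nu sphere_incl p x.
  by apply: EFin_inj; rewrite nrmE Bp_norm_proot.
have QG := gauss_law_distribution gZ.
set Q : probability (borel_rV R n) R := distribution P Z in QG.
have me := @measurable_sphere_incl R n.
have e01 := @sphere_incl01 R n.
have mE : m = pcenter nu sphere_incl Q p.
  (* The expectation depends only on the law [Q] of Z, so it is transported to R^n; the tail and the
     variance are treated in the same way. *)
  rewrite /m /pcenter /Rintegral expectation.unlock; congr fine.
  rewrite (ge0_integral_distribution Z (f := EFin \o proot nu sphere_incl p)) /=.
  - by apply: eq_integral => w _; rewrite /X nrmE.
  - by apply/measurable_EFinP; exact: measurable_proot.
  - by move=> y; rewrite lee_fin proot_ge0.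
have XE : X = proot nu sphere_incl p \o Z by apply/funext => w; rewrite /X nrmE.
split=> [eps eps01|].
  have h := proot_tail me e01 iso QG p2 n0 eps01.
  clearbody X m; rewrite {X}XE {m}mE.
  set a := pcenter nu sphere_incl Q p in h *.
  have QE (A : set (borel_rV R n)) : Q A = P (Z @^-1` A) by [].
  rewrite QE in h; clearbody a.
  apply: (le_trans _ h).
  by [].
rewrite /variance covariance.unlock -/m mE expectation.unlock.
apply: le_trans (proot_variance_pcenter me e01 iso QG p2 n0).
rewrite (ge0_integral_distribution Z
  (f := fun x => ((proot nu sphere_incl p x - pcenter nu sphere_incl Q p) ^+ 2)%:E)).
- by clearbody X; rewrite XE le_eqVlt; apply/orP; left; apply/eqP; apply: eq_integral => w _; rewrite /= expr2.
- apply/measurable_EFinP/measurable_funX/measurable_funB => //.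
  exact: measurable_proot.
- by move=> y; rewrite lee_fin sqr_ge0.
Qed.
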